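(* Let $(E,Q_E\equiv\{l_k\}_{k\ge 1})$ be a Lie $\infty$-algebra of finite dimension, with modular function $\omega_E\in\mathcal E_{+1}$. Then: (1) $\omega_E$ is $Q_E$-closed, i.e. $Q_E(\omega_E)=0$; (2) $\omega_E$ coincides with the divergence of the vector field $Q_E$, i.e. $\omega_E=\mathrm{div}(Q_E)$.
   Context: Graded vector spaces are $\mathbb Z$-graded over $\mathbb K=\mathbb R$ or $\mathbb C$, of finite total dimension; $|x|$ is the degree of $x$, and $(E^* )_i=(E_{-i})^*$. $S(E)$ is the graded symmetric algebra with product $\odot$ ($x\odot y=(-1)^{|x||y|}y\odot x$). The Koszul sign $\epsilon(\sigma)$ is defined by $x_{\sigma(1)}\odot\cdots\odot x_{\sigma(n)}=\epsilon(\sigma)\,x_1\odot\cdots\odot x_n$, and $Sh(i,n-i)$ is the set of $\sigma\in S_n$ with $\sigma(1)<\dots<\sigma(i)$ and $\sigma(i+1)<\dots<\sigma(n)$. A (symmetric) Lie $\infty$-algebra structure on $E$ is a family of degree $+1$ linear maps $l_k:S^k(E)\to E$, $k\ge1$, with $$\sum_{i+j=n+1}\sum_{\sigma\in Sh(i,j-1)}\epsilon(\sigma)\,l_j(l_i(x_{\sigma(1)},\dots,x_{\sigma(i)}),x_{\sigma(i+1)},\dots,x_{\sigma(n)})=0$$ for all $n\ge 1$ and homogeneous $x_1,\dots,x_n\in E$. Identify $S^k(E^* )$ with $(S^kE)^*$ via $(f_1\odot\cdots\odot f_k)(x_1\odot\cdots\odot x_k)=\sum_{\sigma\in S_k}\epsilon(\sigma)(f_1\otimes\cdots\otimes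 f_k)(x_{\sigma(1)}\otimes\cdots\otimes x_{\sigma(k)})$, with the Koszul rule $(f\otimes g)(x\otimes y)=(-1)^{|x||g|}f(x)g(y)$ (iterated). The algebra of functions $\mathcal E$ consists of formal sums $F=\sum_{k\ge1}F^{(k)}$ with $F^{(k)}\in S^k(E^* )$ (arity $k$); $\underline{\mathcal E}$ is the same with $k\ge0$ (unit added); $\mathcal E_n$ denotes functions of degree $n$. The derivation $Q_E:\mathcal E\to\mathcal E$ of degree $+1$, squaring to zero, is $Q_E=\sum_{k\ge0}Q_E^{(k)}$ with $Q_E^{(k)}(\xi)(x_1\odot\cdots\odot x_{k+1})=(-1)^{|\xi|}\langle\xi,l_{k+1}(x_1,\dots,x_{k+1})\rangle$ for $\xi\in E^*$. Modular function: $\omega_E=\sum_{k\ge1}\omega^{(k)}$, where $\omega^{(k)}\in S^k(E^* )_{+1}$ is given, for homogeneous $x_1,\dots,x_k\in E$ whose degrees add up to $-1$, by $\omega^{(k)}(x_1,\dots,x_k)=\mathrm{Str}\big(\mathrm{ad}^{(k)}_{x_1\odot\cdots\odot x_k}\big)$, where $\mathrm{ad}^{(k)}_{x_1\odot\cdots\odot x_k}=l_{k+1}(x_1,\dots,x_k,-)$ is a degree $0$ endomorphism of $E$ and $\mathrm{Str}(\phi)=\sum_i(-1)^i\mathrm{tr}(\phi|_{E_i})$. Divergence: for a homogeneous basis $\xi^1,\dots,\xi^n$ of $E^*$ and a derivation $Q$ of $\mathcal E$ of degree $i$, $\mathrm{div}(Q)=(-1)^{i+1}\sum_{j=1}^n\frac{\partial}{\partial\xi^j}\big(Q(\xi^j)\big)\in\underline{\mathcal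 E}$, where $\frac{\partial}{\partial\xi^j}$ is the graded (left) derivation with $\frac{\partial}{\partial \xi^j}\xi^k=\delta_j^k$. *)

(* Defs.v *)
From HB Require Import structures.
From mathcomp Require Import all_boot all_order all_algebra all_fingroup.
From mathcomp Require Import reals complex.

Set Implicit Arguments.
Unset Strict Implicit.
Unset Printing Implicit Defensive.

Import GRing.Theory.
Local Open Scope ring_scope.

(* [supp] is a finite set of degrees outside of which the pieces vanish; it
   may contain degrees whose piece is zero. *)
Record grading (K : fieldType) (E : vectType K) := Grading {
  piece :> int -> {vspace E};
  supp : seq int;
  supp_uniq : uniq supp;
  piece_out : forall i : int, i \notin supp -> piece i = 0%VS;
  piece_direct : directv (\sum_(i <- supp) piece i);
  piece_full : fullv = (\sum_(i <- supp) piece i)%VS }.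

Section Permutations.

Variables (K : fieldType) (T : Type).

(* (x_1, ..., x_n) |-> (x_sigma(1), ..., x_sigma(n)) *)
Definition permute (t : seq T) (sigma : 'S_(size t)) : seq T :=
  [seq tnth (in_tuple t) (sigma a) | a <- enum 'I_(size t)].

(* Sh(i, n - i), with 0-based positions. *)
Definition Sh (n i : nat) : {set 'S_n} :=
  [set sigma : 'S_n | [forall a : 'I_n, forall b : 'I_n,
     ((a < b < i) || (i <= a < b))%N ==> (sigma a < sigma b)%N]].

(* The sign relating x_sigma(1) . ... . x_sigma(n) to x_1 . ... . x_n: every
   inversion of sigma exchanges two factors x, y once, at the cost of a factor
   (-1)^(|x||y|).  Elements come paired with their degree. *)
Definition koszul (t : seq (int * T)) (sigma : 'S_(size t)) : K :=
  \prod_(a < size t) \prod_(b < size t | (a < b)%N && (sigma b < sigma a)%N)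
    (-1) ^ ((tnth (in_tuple t) (sigma a)).1 * (tnth (in_tuple t) (sigma b)).1).

Definition tdeg (t : seq (int * T)) : int := \sum_(p <- t) p.1.

End Permutations.

Arguments koszul K {T} t sigma.

Section GradedSpaces.

Variables (K : fieldType) (E : vectType K) (gr : grading E).

Definition hproj (i : int) : 'End(E) := sumv_pi_for (piece_full gr) i.

(* Sequences of homogeneous elements, each paired with its degree (the pairing
   is needed because 0 is homogeneous of every degree). *)
Definition homog (t : seq (int * E)) : bool := all (fun p => p.2 \in gr p.1) t.

(* A family of k-linear maps on E, k >= 0, is a function on seq E: the map of
   arity k is the restriction to sequences of size k. *)
Definition multilinear (V : lmodType K) (f : seq E -> V) : Prop :=
  forall (s1 s2 : seq E) (a : K) (x y : E),
    f (s1 ++ (a *: x + y) :: s2) = a *: f (s1 ++ x :: s2) + f (s1 ++ y :: s2).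

Definition gsymmetric (V : lmodType K) (f : seq E -> V) : Prop :=
  forall (s1 s2 : seq E) (p q : int) (x y : E), x \in gr p -> y \in gr q ->
    f (s1 ++ x :: y :: s2) = (-1) ^ (p * q) *: f (s1 ++ y :: x :: s2).

(* The multilinear extension of data given on homogeneous sequences. *)
Fixpoint hom_ext (phi : seq (int * E) -> K^o) (s : seq E) : K^o :=
  if s is x :: s' then
    \sum_(i <- supp gr) hom_ext (fun t => phi ((i, hproj i x) :: t)) s'
  else phi [::].

(* By the universal property, linear maps out of S^k(E) are the graded
   symmetric k-linear maps.  The value at [::] is only there because of the
   encoding: there is no operation of arity 0. *)
Record Linfty (l : seq E -> E) : Prop := {
  Linfty_nil : l [::] = 0;
  Linfty_multilinear : multilinear l;
  Linfty_gsymmetric : gsymmetric l;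
  Linfty_degree : forall t, homog t -> l (unzip2 t) \in gr (tdeg t + 1);
  Linfty_jacobi : forall t, homog t -> (0 < size t)%N ->
    \sum_(1 <= i < (size t).+1) \sum_(sigma in Sh (size t) i)
      koszul K t sigma *:
        l (l (take i (unzip2 (permute sigma)))
             :: drop i (unzip2 (permute sigma))) = 0 }.

(* Candidates for formal sums of elements of S^k(E^* ) = (S^k E)^*. *)
Definition func : Type := seq E -> K^o.

Definition ufunctions (F : func) : Prop := multilinear F /\ gsymmetric F.

Definition functions (F : func) : Prop := ufunctions F /\ F [::] = 0.

(* (E^* )_i = (E_{-i})^*, so F has degree n iff it only sees arguments whose
   degrees add up to -n. *)
Definition has_degree (n : int) (F : func) : Prop :=
  forall t, homog t -> tdeg t != - n -> F (unzip2 t) = 0.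

(* The product of S(E^* ) transported to graded symmetric forms:
   (F . G)(x_1 . ... . x_n) is the sum over shuffles of
   eps(sigma) (F (x) G)(x' (x) x''), where x' and x'' are the first i and the
   last n - i of the x_sigma(a).  The Koszul rule gives (-1)^(|x'||G|), which
   is (-1)^(|x'||x''|) since G(x'') = 0 unless |G| = - |x''|; in this form the
   sign also makes sense for G not homogeneous. *)
Definition gmul (F G : func) : func :=
  hom_ext (fun t =>
    \sum_(i < (size t).+1) \sum_(sigma in Sh (size t) i)
      koszul K t sigma
      * (-1) ^ (tdeg (take i (permute sigma)) * tdeg (drop i (permute sigma)))
      * F (unzip2 (take i (permute sigma)))
      * G (unzip2 (drop i (permute sigma)))).

(* Degree i (left) graded derivations of A, where A is [functions] or
   [ufunctions]. *)
Record derivation (A : func -> Prop) (i : int) (D : func -> func) : Prop := {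
  der_stable : forall F, A F -> A (D F);
  der_linear : forall a F G, A F -> A G ->
    D (fun s => a *: F s + G s) =1 (fun s => a *: D F s + D G s);
  der_degree : forall n F, A F -> has_degree n F -> has_degree (n + i) (D F);
  der_leibniz : forall n F G, A F -> A G -> has_degree n F ->
    D (gmul F G) =1
      (fun s => gmul (D F) G s + (-1) ^ (i * n) *: gmul F (D G) s) }.

Definition of_dual (xi : 'Hom(E, K^o)) : func :=
  fun s => if s is [:: x] then xi x else 0.

Definition of_const (c : K) : func := fun s => if s is [::] then c else 0.

Definition dual_homog (i : int) (xi : 'Hom(E, K^o)) : Prop :=
  forall (j : int) (x : E), x \in gr j -> j != - i -> xi x = 0.

(* Q is the derivation Q_E attached to l. *)
Record is_QE (l : seq E -> E) (Q : func -> func) : Prop := {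
  QE_derivation : derivation functions 1 Q;
  QE_dual : forall (i : int) (xi : 'Hom(E, K^o)), dual_homog i xi ->
    forall s : seq E, Q (of_dual xi) s = (-1) ^ i *: xi (l s) }.

(* tr(f|_U) for a linear f mapping U to itself. *)
Definition trace_on (U : {vspace E}) (f : E -> E) : K :=
  \sum_(j < \dim U) coord (vbasis U) j (f (vbasis U)`_j).

Definition Str (f : E -> E) : K :=
  \sum_(i <- supp gr) (-1) ^ i * trace_on (gr i) f.

Definition ad (l : seq E -> E) (s : seq E) : E -> E := fun y => l (rcons s y).

(* The vanishing when the degrees do not add up to -1 expresses that the
   modular function has degree +1. *)
Definition modular_function (l : seq E -> E) : func :=
  hom_ext (fun t =>
    if (t != [::]) && (tdeg t == -1) then Str (ad l (unzip2 t)) else 0).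

Definition dual_basis_homog (n : nat) (d : 'I_n -> int)
    (xi : n.-tuple 'Hom(E, K^o)) : Prop :=
  basis_of fullv xi /\ forall j, dual_homog (d j) (tnth xi j).

(* D j is d/d(xi^j). *)
Definition partials (n : nat) (d : 'I_n -> int) (xi : n.-tuple 'Hom(E, K^o))
    (D : 'I_n -> func -> func) : Prop :=
  forall j, derivation ufunctions (- d j) (D j) /\
    forall k, D j (of_dual (tnth xi k)) =1 of_const (j == k)%:R.

(* The divergence of a derivation Q of degree i, for a basis xi of E^* and the
   associated partial derivatives D. *)
Definition divergence (n : nat) (xi : n.-tuple 'Hom(E, K^o))
    (D : 'I_n -> func -> func) (i : int) (Q : func -> func) : func :=
  fun s => (-1) ^ (i + 1) *: \sum_(j < n) D j (Q (of_dual (tnth xi j))) s.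

End GradedSpaces.

(* Main.v *)
Require Import Defs.
From mathcomp Require Import all_boot all_order all_algebra all_fingroup.
From mathcomp Require Import reals complex boolp zify ring.

Set Implicit Arguments.
Unset Strict Implicit.
Unset Printing Implicit Defensive.

Import GRing.Theory Num.Theory.
Local Open Scope ring_scope.

(** Shuffle sums over permutations are turned into a structurally recursive
    sum [unsh] (the coproduct of S(E)), which is coassociative and graded
    cocommutative.  A derivation of the functions is determined by its values
    on a basis of E^*, because Euler's formula writes a function of arity k > 1
    as a sum of products of linear functions with functions of arity k - 1.
    This identifies d/d(xi^j) with the insertion of the dual vector e_j in the
    last argument, and Q with
      (Q F)(t) = (-1)^(|t|+1) sum eps F(l(t'), t'').
    Part (2) is then the formula Str f = sum_j (-1)^|xi^j| xi^j (f e_j).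
    For part (1), the Jacobi identity on (t, y) expresses
    sum eps l(l(t'), t'', y) as - sum eps ad_t''(ad_t'(y)), where the sign uses
    |t| = -2, and the supertrace of the latter sum equals its opposite because
    exchanging t' and t'' preserves the sum while Str is graded cyclic. *)

(** * Signs *)

Definition oddz (n : int) : bool := odd `|n|%N.

Lemma oddzD m n : oddz (m + n) = oddz m (+) oddz n.
Proof. rewrite /oddz; lia. Qed.

Lemma oddzN n : oddz (- n) = oddz n.
Proof. by rewrite /oddz abszN. Qed.

Lemma oddzM m n : oddz (m * n) = oddz m && oddz n.
Proof. by rewrite /oddz abszM oddM. Qed.

Lemma oddz1 : oddz 1.
Proof. by []. Qed.

Definition oddzE := (oddzD, oddzN, oddzM, oddz1).

Section Signs.

Variable K : fieldType.
Implicit Types m n : int.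

Lemma signzE n : (-1) ^ n = (-1) ^+ oddz n :> K.
Proof.
rewrite /oddz signr_odd; case: n => n //=.
by rewrite NegzE -exprnN invr_sign.
Qed.

Lemma signzM m n : (-1) ^ m * (-1) ^ n = (-1) ^ (m + n) :> K.
Proof. by rewrite !signzE oddzD signr_addb. Qed.

Lemma eq_signz m n : oddz m = oddz n -> (-1) ^ m = (-1) ^ n :> K.
Proof. by rewrite !signzE => ->. Qed.

Lemma signzK n : (-1) ^ n * (-1) ^ n = 1 :> K.
Proof. by rewrite signzM signzE oddzD addbb. Qed.

End Signs.

(** A sign depends only on the parity of its exponent, so once the signs are merged an identity
    between them is checked on the truth values of the parities. *)
Ltac signz := rewrite ?mulrA ?signzM; apply: eq_signz; rewrite ?oddzE;
  repeat match goal with |- context [oddz ?n] => case: (oddz n) end; by [].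

(** * Unshuffle sums *)

Section Unshuffles.

Variables (K : fieldType) (T : eqType).
Implicit Types (t u v : seq (int * T)) (x y : int * T).

Lemma tdeg_cons x t : tdeg (x :: t) = x.1 + tdeg t.
Proof. by rewrite /tdeg big_cons. Qed.

Lemma tdeg_nil : tdeg ([::] : seq (int * T)) = 0.
Proof. by rewrite /tdeg big_nil. Qed.

Lemma tdeg_cat u v : tdeg (u ++ v) = tdeg u + tdeg v.
Proof. by rewrite /tdeg big_cat. Qed.

Lemma tdeg_rcons t x : tdeg (rcons t x) = tdeg t + x.1.
Proof. by rewrite -cats1 tdeg_cat tdeg_cons tdeg_nil addr0. Qed.

Lemma perm_tdeg u v : perm_eq u v -> tdeg u = tdeg v.
Proof. exact: perm_big. Qed.

(* The sum of eps * Phi u v over all the ways to unshuffle t into u and v,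
   where eps is the Koszul sign of the rearrangement of t into u ++ v. *)
Fixpoint unsh (V : lmodType K)
    (Phi : seq (int * T) -> seq (int * T) -> V) t : V :=
  if t is x :: t' then
    unsh (fun u v => Phi (x :: u) v) t'
    + unsh (fun u v => (-1) ^ (x.1 * tdeg u) *: Phi u (x :: v)) t'
  else Phi [::] [::].

Section Target.

Variable V : lmodType K.
Implicit Types Phi Psi : seq (int * T) -> seq (int * T) -> V.

(** The blocks together rearrange [t]; this restriction is what makes degrees, sizes and homogeneity
    of [t] available under the sum. *)
Lemma eq_unsh Phi Psi t :
    (forall u v, perm_eq (u ++ v) t -> Phi u v = Psi u v) ->
  unsh Phi t = unsh Psi t.
Proof.
elim: t Phi Psi => [|x t IH] Phi Psi H /=; first exact: H.
congr (_ + _); apply: IH => u v uv; first by apply: H; rewrite /= perm_cons.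
congr (_ *: _); apply: H; rewrite -(perm_cons x) in uv.
by apply: perm_trans uv; rewrite -cat1s perm_catCA.
Qed.

Lemma unshD Phi Psi t :
  unsh (fun u v => Phi u v + Psi u v) t = unsh Phi t + unsh Psi t.
Proof.
elim: t Phi Psi => [|x t IH] Phi Psi //=; rewrite [RHS]addrACA.
congr (_ + _); rewrite -IH //.
by apply: eq_unsh => u v _; rewrite scalerDr.
Qed.

Lemma unshZ a Phi t : unsh (fun u v => a *: Phi u v) t = a *: unsh Phi t.
Proof.
elim: t Phi => [|x t IH] Phi //=; rewrite scalerDr; congr (_ + _); rewrite -IH //.
by apply: eq_unsh => u v _; rewrite !scalerA mulrC.
Qed.

Lemma unsh0 t : unsh (fun _ _ => 0 : V) t = 0.
Proof.
rewrite -[RHS](scale0r (unsh (fun _ _ => 0) t)) -unshZ.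
by apply: eq_unsh => *; rewrite scale0r.
Qed.

Lemma unsh_sum (I : Type) (r : seq I) (Phi : I -> _ -> _ -> V) t :
  unsh (fun u v => \sum_(i <- r) Phi i u v) t = \sum_(i <- r) unsh (Phi i) t.
Proof.
elim: r => [|i r IH].
  by rewrite big_nil -[RHS](unsh0 t); apply: eq_unsh => u v _; rewrite big_nil.
by rewrite big_cons -IH -unshD; apply: eq_unsh => u v _; rewrite big_cons.
Qed.

(** The last letter [y] either closes the first block, after crossing all of [v], or closes the
    second one, crossing nothing. *)
Lemma unsh_rcons Phi t y :
  unsh Phi (rcons t y) =
    unsh (fun u v => (-1) ^ (y.1 * tdeg v) *: Phi (rcons u y) v) t
    + unsh (fun u v => Phi u (rcons v y)) t.
Proof.
elim: t Phi => [|x t IH] Phi /=; first by rewrite tdeg_nil mulr0 !scale1r.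
rewrite !IH addrACA; congr (_ + _ + (_ + _)).
apply: eq_unsh => u v _; rewrite !scalerA tdeg_rcons tdeg_cons.
by congr (_ *: _); signz.
Qed.

(** Graded cocommutativity: the sign is that of moving one whole block across the other. *)
Lemma unsh_swap Phi t :
  unsh Phi t = unsh (fun u v => (-1) ^ (tdeg u * tdeg v) *: Phi v u) t.
Proof.
elim: t Phi => [|x t IH] Phi /=; first by rewrite tdeg_nil mulr0 scale1r.
rewrite addrC (IH (fun u v => Phi (x :: u) v)).
rewrite (IH (fun u v => _ *: Phi u (x :: v))).
congr (_ + _); apply: eq_unsh => u v _; rewrite !scalerA tdeg_cons;
  by congr (_ *: _); signz.
Qed.

(** Counit law: the only unshuffle with empty second block is the trivial one, and its sign is 1. *)
Lemma unsh_nilr (f : seq (int * T) -> V) t :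
  unsh (fun u v => if v is [::] then f u else 0) t = f t.
Proof.
elim: t f => [|x t IH] f //=; rewrite IH -[RHS]addr0; congr (_ + _).
by rewrite -[RHS](unsh0 t); apply: eq_unsh => u v _; rewrite scaler0.
Qed.

Lemma unsh_nill (f : seq (int * T) -> V) t :
  unsh (fun u v => if u is [::] then f v else 0) t = f t.
Proof.
rewrite unsh_swap -[RHS](unsh_nilr f); apply: eq_unsh => u [|y v] _.
  by rewrite tdeg_nil mulr0 scale1r.
by rewrite scaler0.
Qed.

(** Coassociativity: both sides distribute [t] into three blocks, with the sign of the rearrangement
    of [t] into their concatenation. *)
Lemma unsh_assoc (Phi : _ -> _ -> _ -> V) t :
  unsh (fun u w => unsh (fun v z => Phi u v z) w) t =
  unsh (fun w z => unsh (fun u v => Phi u v z) w) t.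
Proof.
elim: t Phi => [|x t IH] Phi //=; rewrite IH unshD -addrA; congr (_ + _).
(* The case of [x] in the first block is settled; here [x] joins the second block, or the third one,
   in which case it crosses [v] as well as [u]. *)
transitivity (unsh (fun u w =>
    unsh (fun v z => (-1) ^ (x.1 * tdeg u) *: Phi u (x :: v) z) w) t +
  unsh (fun u w => unsh (fun v z =>
    (-1) ^ (x.1 * (tdeg u + tdeg v)) *: Phi u v (x :: z)) w) t).
  rewrite -unshD; apply: eq_unsh => u w _; rewrite scalerDr -!unshZ.
  congr (_ + _); apply: eq_unsh => v z _; rewrite ?scalerA //.
  by congr (_ *: _); signz.
rewrite !IH; congr (_ + _); apply: eq_unsh => w z _.
rewrite -unshZ; apply: eq_unsh => u v uv.
by rewrite -tdeg_cat (perm_tdeg uv).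
Qed.

(** If [x] and [y] fall in the same block, the symmetry of [Phi] applies; if not, exchanging them
    only changes the sign of the rearrangement. [P] is there to carry homogeneity. *)
Lemma unsh_sym (P : pred (int * T)) Phi t1 x y t2 :
    (forall u1 u2 v, all P (u1 ++ x :: y :: u2) -> all P v ->
       Phi (u1 ++ x :: y :: u2) v =
         (-1) ^ (x.1 * y.1) *: Phi (u1 ++ y :: x :: u2) v) ->
    (forall u v1 v2, all P u -> all P (v1 ++ x :: y :: v2) ->
       Phi u (v1 ++ x :: y :: v2) =
         (-1) ^ (x.1 * y.1) *: Phi u (v1 ++ y :: x :: v2)) ->
    all P (t1 ++ x :: y :: t2) ->
  unsh Phi (t1 ++ x :: y :: t2) =
    (-1) ^ (x.1 * y.1) *: unsh Phi (t1 ++ y :: x :: t2).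
Proof.
elim: t1 Phi => [|z t1 IH] Phi Hl Hr /=.
  move=> /and3P[Px Py Pt]; rewrite !scalerDr -!unshZ.
  (* After this regrouping each term faces the one with the same letters in each block. *)
  rewrite addrACA; congr (_ + _ + (_ + _));
    apply: eq_unsh => u v uv; have := perm_all P uv; rewrite Pt all_cat => /andP[Pu Pv].
  - by rewrite (Hl [::]) //= Px Py.
  - by rewrite !scalerA; congr (_ *: _); rewrite ?tdeg_cons; signz.
  - by rewrite !scalerA; congr (_ *: _); rewrite ?tdeg_cons; signz.
  - rewrite !scalerA (Hr u [::]) ?scalerA /= ?Px ?Py //.
    by congr (_ *: _); rewrite ?tdeg_cons; signz.
move=> /andP[Pz Pt]; rewrite scalerDr; congr (_ + _); apply: IH => //.
- by move=> u1 u2 v Pu Pv; rewrite (Hl (z :: u1)) //= Pz.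
- by move=> u v1 v2 Pu Pv; rewrite Hr //= Pz.
- move=> u1 u2 v Pu Pv; rewrite Hl //= ?Pz // !scalerA !tdeg_cat !tdeg_cons.
  by congr (_ *: _); signz.
- move=> u v1 v2 Pu Pv; rewrite (Hr u (z :: v1)) //= ?Pz // !scalerA.
  by congr (_ *: _); signz.
Qed.

End Target.

Lemma linear_unsh (V W : lmodType K) (f : {linear V -> W}) Phi t :
  f (unsh Phi t) = unsh (fun u v => f (Phi u v)) t.
Proof.
elim: t Phi => [|x t IH] Phi //=; rewrite linearD !IH; congr (_ + _).
by apply: eq_unsh => u v _; rewrite linearZ.
Qed.

End Unshuffles.

(** * Shuffles as permutations *)

Section ShufflePermutations.

Variables (K : fieldType) (T : eqType).
Implicit Types (t : seq (int * T)) (x : int * T).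

Lemma size_permute t (s : 'S_(size t)) : size (permute s) = size t.
Proof. by rewrite size_map size_enum_ord. Qed.

Lemma nth_permute x0 t (s : 'S_(size t)) (a : 'I_(size t)) :
  nth x0 (permute s) a = nth x0 t (s a).
Proof.
rewrite /permute (nth_map a) ?size_enum_ord // nth_ord_enum.
by rewrite (tnth_nth x0).
Qed.

(** [lift_perm k ord0 s] puts the first letter at position [k] and arranges the others by [s]; this
    is the recursion on permutations that matches [unsh]. *)
Lemma permute_lift x t (k : 'I_(size t).+1) (s : 'S_(size t)) :
  @permute _ (x :: t) (lift_perm k ord0 s) =
    take k (permute s) ++ x :: drop k (permute s).
Proof.
have kt : (k <= size t)%N by rewrite -ltnS.
have sz : size (take k (permute s)) = k.
  by rewrite size_take size_permute; case: ltngtP kt.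
apply: (@eq_from_nth _ x) => [|i].
  rewrite size_permute size_cat /= sz size_drop size_permute.
  by rewrite addnS subnKC.
rewrite size_permute => lti.
rewrite (@nth_permute x (x :: t) (lift_perm k ord0 s) (Ordinal lti)).
case: (unliftP k (Ordinal lti)) => [j|] def_i; rewrite def_i.
  rewrite lift_perm_lift lift0 /= -(nth_permute x s).
  have -> : i = bump k j by exact: (congr1 (@nat_of_ord _) def_i).
  rewrite nth_cat sz /bump; have [kj | jk] := leqP k j.
    by rewrite (_ : true + j = j.+1)%N // ltnNge leqW //= subSn //= nth_drop subnKC.
  by rewrite (_ : false + j = j)%N // jk nth_take.
have -> : i = k by exact: (congr1 (@nat_of_ord _) def_i).
by rewrite lift_perm_id nth_cat sz ltnn subnn.
Qed.

(** Since [x] is the first letter, its inversions are exactly those with the [k] letters placed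
    before it. *)
Lemma koszul_lift x t (k : 'I_(size t).+1) (s : 'S_(size t)) :
  koszul K (x :: t) (lift_perm k ord0 s) =
    (-1) ^ (x.1 * tdeg (take k (permute s))) * koszul K t s.
Proof.
have kt : (k <= size t)%N by rewrite -ltnS.
rewrite /koszul (bigD1_ord k) //= big1 ?mul1r => [|b]; last first.
  by rewrite lift_perm_id ltn0 andbF.
have -> : (-1) ^ (x.1 * tdeg (take k (permute s))) =
    \prod_(a < size t | (a < k)%N) (-1) ^ (x.1 * (nth x t (s a)).1) :> K.
  have -> : tdeg (take k (permute s)) =
      \sum_(a < size t | (a < k)%N) (nth x t (s a)).1.
    rewrite /tdeg (big_nth x) big_mkord size_take size_permute.
    have -> : (if (k < size t)%N then nat_of_ord k else size t) = k.
      by case: ltngtP kt.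
    rewrite (big_ord_widen _ (fun i => (nth x (take k (permute s)) i).1) kt).
    by apply: eq_bigr => a ak; rewrite nth_take // nth_permute.
  rewrite mulr_sumr; elim/big_rec2: _ => [|a e f _ <-]; first by rewrite expr0z.
  by rewrite signzM.
rewrite [in RHS]big_mkcond -big_split /=; apply: eq_bigr => a _.
rewrite big_mkcond (bigD1_ord k) //= lift_perm_id lift_perm_lift lift0 ltn0Sn andbT.
congr (_ * _).
  have -> : (bump k a < k)%N = (a < k)%N by rewrite /bump; case: leqP; lia.
  by rewrite !(tnth_nth x) ?lift_perm_lift ?lift_perm_id /= mulrC.
rewrite [RHS]big_mkcond; apply: eq_bigr => b _; rewrite !lift_perm_lift /=.
rewrite !(tnth_nth x) /= ?lift_perm_lift.
have -> : (bump k a < bump k b)%N = (a < b)%N by rewrite /bump; do 2!case: leqP; lia.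
by [].
Qed.

(** In a shuffle the smallest value heads its block: it sits at position 0 if it lies in the first
    block, which is then nonempty, and at position [i] otherwise. *)
Lemma Sh_lift n i (k : 'I_n.+1) (s : 'S_n) :
  (lift_perm k ord0 s \in Sh n.+1 i) =
    [&& 0 < i, k == 0 :> nat & s \in Sh n i.-1]%N ||
    (k == i :> nat) && (s \in Sh n i).
Proof.
have kn := ltn_ord k.
have ShP m j (r : 'S_m) : reflect (forall a b : 'I_m,
    ((a < b < j) || (j <= a < b))%N -> (r a < r b)%N) (r \in Sh m j).
  rewrite inE; apply: (iffP forallP) => H a.
    by move=> b; apply/implyP; move/forallP: (H a).
  by apply/forallP => b; apply/implyP/H.
have bumpE (a : 'I_n) : bump k a = (a + (k <= a))%N by rewrite /bump addnC.
apply/ShP/orP => [H | H a b].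
  have Hs (a b : 'I_n) : ((bump k a < bump k b < i) || (i <= bump k a < bump k b))%N ->
      (s a < s b)%N.
    by move=> ab; have := H (lift k a) (lift k b) ab; rewrite !lift_perm_lift !lift0.
  have Hk (a : 'I_n) : ~~ ((bump k a < k < i) || (i <= bump k a < k))%N.
    by apply/negP => ak; have := H (lift k a) k ak; rewrite lift_perm_id.
  have {Hk} : (k == i :> nat) || ((0 < i) && (k == 0 :> nat))%N.
    case: (ltngtP k i) => //= ki.
      case: (posnP k) => k0; first by lia.
      have lt0n : (0 < n)%N by lia.
      by have := Hk (Ordinal lt0n); rewrite bumpE /=; lia.
    have lti : (i < n)%N by lia.
    by have := Hk (Ordinal lti); rewrite bumpE /=; lia.
  case/orP => [/eqP ki|/andP[i0 /eqP k0]]; [right | left].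
    by rewrite ki eqxx; apply/ShP => a b ab; apply: Hs; rewrite !bumpE ki; lia.
  by rewrite i0 k0; apply/ShP => a b ab; apply: Hs; rewrite !bumpE k0; lia.
case: (unliftP k a) => [a'|] ->; case: (unliftP k b) => [b'|] ->;
  rewrite ?lift_perm_lift ?lift_perm_id ?lift0 //=; rewrite ?bumpE.
- case: H => [/and3P[i0 /eqP k0 /ShP Hs] | /andP[/eqP ki /ShP Hs]] ab;
    rewrite ltnS; apply: Hs; move: ab; rewrite ?ki ?k0; lia.
- case: H => [/and3P[i0 /eqP k0 _] | /andP[/eqP ki _]]; rewrite ?ki ?k0; lia.
- by rewrite ltnn andbF.
Qed.

Lemma lift_perm_bij n :
  bijective (fun p : 'I_n.+1 * 'S_n => lift_perm p.1 ord0 p.2).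
Proof.
apply: inj_card_bij => [[k s] [k' s'] /= eq_ss|]; last first.
  by rewrite card_prod card_ord !card_Sn factS.
have kk : k = k'.
  apply: (@perm_inj _ (lift_perm k ord0 s)).
  by rewrite lift_perm_id eq_ss lift_perm_id.
rewrite -kk in eq_ss *; congr (_, _); apply/permP => a.
apply: (@lift_inj _ ord0); rewrite -!(lift_perm_lift k).
by rewrite eq_ss.
Qed.

(** Sorting the shuffles by the block that receives the first letter turns the sum over permutations
    into the recursion of [unsh]. *)
Lemma sum_Sh_unsh (V : lmodType K) (Phi : _ -> _ -> V) t :
  \sum_(i < (size t).+1) \sum_(s in Sh (size t) i)
    koszul K t s *: Phi (take i (permute s)) (drop i (permute s)) = unsh Phi t.
Proof.
elim: t Phi => [|x t IH] Phi.
  rewrite big_ord1 (bigD1 1%g) ?big1 /=; first last.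
  - by rewrite inE; apply/forallP => -[].
  - by move=> s /andP[_ /eqP[]]; apply/permP => -[].
  rewrite addr0 /koszul big_ord0 scale1r.
  by case: (permute _) (size_permute (1%g : 'S_(size [::]))).
pose f i (p : 'I_(size t).+1 * 'S_(size t)) :=
  koszul K (x :: t) (lift_perm p.1 ord0 p.2) *:
    Phi (take i (@permute _ (x :: t) (lift_perm p.1 ord0 p.2)))
        (drop i (@permute _ (x :: t) (lift_perm p.1 ord0 p.2))).
transitivity (\sum_(i < (size t).+2) \sum_(k < (size t).+1)
  \sum_(s | lift_perm k ord0 s \in Sh (size t).+1 i) f i (k, s)).
  apply: eq_bigr => i _; rewrite pair_big_dep /=.
  by rewrite (reindex _ (onW_bij _ (lift_perm_bij _))) /=; apply: eq_bigr => -[].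
transitivity (\sum_(i < (size t).+2) \sum_(k < (size t).+1)
    \sum_(s | [&& 0 < i, k == 0 :> nat & s \in Sh (size t) i.-1]%N) f i (k, s) +
  \sum_(i < (size t).+2) \sum_(k < (size t).+1)
    \sum_(s | (k == i :> nat) && (s \in Sh (size t) i)) f i (k, s)).
  rewrite -big_split; apply: eq_bigr => i _.
  rewrite -big_split; apply: eq_bigr => k _.
  rewrite big_mkcond [X in _ = X + _]big_mkcond [X in _ = _ + X]big_mkcond.
  rewrite -big_split; apply: eq_bigr => s _; rewrite Sh_lift /=.
  (* The two alternatives exclude each other: [k = 0] and [k = i] conflict when [0 < i]. *)
  case: ifP => [/orP[A|B]|/norP[/negbTE-> /negbTE->]]; last by rewrite addr0.
    rewrite A ifF ?addr0 //; case/and3P: A => i0 /eqP-> _.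
    by apply/negbTE; rewrite negb_and neq_ltn i0.
  rewrite B ifF ?add0r //; case/andP: B => /eqP-> _.
  by case: (nat_of_ord i).
rewrite /= -!IH; congr (_ + _).
  (* An empty first block cannot receive [x], so the term [i = 0] drops out and the other ones are
     shifted by one. *)
  rewrite big_ord_recl big1 ?add0r => [|k _]; last by rewrite big_pred0.
  apply: eq_bigr => i _; rewrite big_ord_recl [X in _ + X]big1 ?addr0 => [|k _].
    apply: eq_bigr => s _; rewrite /f koszul_lift permute_lift.
    by rewrite /= take0 drop0 tdeg_nil mulr0 expr0z mul1r.
  by rewrite big_pred0.
rewrite exchange_big; apply: eq_bigr => k _ /=.
(* When [x] heads the second block, its position [k] is the size of the first block, so only [i = k]
   contributes. *)
rewrite (bigD1 (widen_ord (leqnSn _) k)) //= [X in _ + X]big1 ?addr0 => [|i].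
  apply: eq_big => [s | s _]; first by rewrite eqxx.
  rewrite /f /= koszul_lift permute_lift.
  have sz : size (take k (permute s)) = k.
    by rewrite size_takel // size_permute -ltnS.
  rewrite -[in LHS]sz take_size_cat ?drop_size_cat ?sz //.
  by rewrite scalerA mulrC.
rewrite -val_eqE /= eq_sym => /negbTE ki.
by rewrite big_pred0 // => s; rewrite ki.
Qed.

End ShufflePermutations.

(** * Multilinear extension of homogeneous data *)

Section HomogeneousExtension.

Variables (K : fieldType) (E : vectType K) (gr : grading E).
Implicit Types (s : seq E) (t u v : seq (int * E)).
Implicit Types phi psi : seq (int * E) -> K^o.

Lemma mem_hproj i x : hproj gr i x \in gr i.
Proof. exact: memv_sum_pi. Qed.

Lemma sum_hproj x : \sum_(i <- supp gr) hproj gr i x = x.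
Proof.
apply: sumv_pi_uniq_sum; first by rewrite filter_predT supp_uniq.
exact: memvf.
Qed.

Lemma hproj_out i x : i \notin supp gr -> hproj gr i x = 0.
Proof.
by move=> /(piece_out (g := gr)) i0; have := mem_hproj i x; rewrite i0 memv0 => /eqP.
Qed.

Lemma hproj_homog i j x : x \in gr j -> hproj gr i x = if i == j then x else 0.
Proof.
move=> xj; have [js|jNs] := boolP (j \in supp gr); last first.
  move: xj; rewrite (piece_out jNs) memv0 => /eqP->.
  by rewrite linear0 if_same.
have [is_|iNs] := boolP (i \in supp gr); last first.
  rewrite hproj_out //; case: eqP => // ij.
  by rewrite ij js in iNs.
pose r := in_tuple (supp gr).
have dir : directv (\sum_(k < size (supp gr)) gr (tnth r k)).
  have := piece_direct gr; rewrite !directvE /= => /eqP dir.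
  by apply/eqP; move: dir; rewrite !(big_tnth _ _ (supp gr)).
(* [us] is the difference of two homogeneous decompositions of [x]; its components add up to 0,
   hence vanish because the sum is direct. *)
pose us k := hproj gr (tnth r k) x - (if tnth r k == j then x else 0).
have us0 k : us k = 0.
  apply: (directv_sum_independent dir) => // [{}k _|].
    rewrite rpredB ?mem_hproj //; case: eqP => [->|_] //; exact: mem0v.
  rewrite sumrB -(big_tnth _ _ (supp gr) xpredT (fun i => hproj gr i x)) sum_hproj.
  rewrite -(big_tnth _ _ (supp gr) xpredT (fun i => if i == j then x else 0)).
  rewrite (bigD1_seq j) ?supp_uniq //= eqxx big1 ?addr0 ?subrr //.
  by move=> k' /negbTE->.
have /tnthP[k ->] : i \in r by [].
by have /eqP := us0 k; rewrite subr_eq0 => /eqP.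
Qed.

Lemma hom_ext_cat phi s1 s2 :
  hom_ext gr phi (s1 ++ s2) =
    hom_ext gr (fun t1 => hom_ext gr (fun t2 => phi (t1 ++ t2)) s2) s1.
Proof.
by elim: s1 phi => [|x s1 IH] phi //=; apply: eq_bigr => i _; rewrite IH.
Qed.

Lemma eq_hom_ext phi psi s :
    (forall t, homog gr t -> size t = size s -> phi t = psi t) ->
  hom_ext gr phi s = hom_ext gr psi s.
Proof.
elim: s phi psi => [|x s IH] phi psi H /=; first exact: H.
apply: eq_bigr => i _; apply: IH => t ht st; apply: H => /=; last by rewrite st.
by rewrite mem_hproj.
Qed.

Lemma hom_ext_linear a phi psi s :
  hom_ext gr (fun t => a *: phi t + psi t) s =
    a *: hom_ext gr phi s + hom_ext gr psi s.
Proof.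
elim: s phi psi => [|x s IH] phi psi //=.
by rewrite scaler_sumr -big_split; apply: eq_bigr => i _; rewrite IH.
Qed.

Lemma hom_ext0 s : hom_ext gr (fun=> 0) s = 0.
Proof. by elim: s => //= x s IH; rewrite big1. Qed.

(** Koszul signs are computed from the degree labels, so linearity is asked for in the vectors with
    the labels fixed. *)
Definition tmultilinear (V : lmodType K) (f : seq (int * E) -> V) : Prop :=
  forall t1 t2 i (a : K) (x y : E),
    f (t1 ++ (i, a *: x + y) :: t2) =
      a *: f (t1 ++ (i, x) :: t2) + f (t1 ++ (i, y) :: t2).

Definition tsymmetric (V : lmodType K) (f : seq (int * E) -> V) : Prop :=
  forall t1 t2 x y, homog gr (t1 ++ x :: y :: t2) ->
    f (t1 ++ x :: y :: t2) = (-1) ^ (x.1 * y.1) *: f (t1 ++ y :: x :: t2).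

Lemma multilinear0 (V : lmodType K) (f : _ -> V) s1 s2 :
  multilinear f -> f (s1 ++ (0 : E) :: s2) = 0.
Proof.
by move=> fM; rewrite -[X in X :: _](addNr 0) -scaleN1r fM scaleN1r addNr.
Qed.

Lemma tmultilinear0 (V : lmodType K) (f : _ -> V) t1 i t2 :
  tmultilinear f -> f (t1 ++ (i, 0) :: t2) = 0.
Proof.
by move=> fM; rewrite -[0](addNr 0) -scaleN1r fM scaleN1r addNr.
Qed.

Lemma tmultilinear_cons (V : lmodType K) (f : _ -> V) x :
  tmultilinear f -> tmultilinear (fun t => f (x :: t)).
Proof. by move=> fM t1; apply: (fM (x :: t1)). Qed.

Lemma multilinear_unzip2 (V : lmodType K) (f : seq E -> V) :
  multilinear f -> tmultilinear (fun t => f (unzip2 t)).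
Proof. by move=> fM t1 t2 i a x y; rewrite /unzip2 !map_cat; apply: fM. Qed.

Lemma gsymmetric_unzip2 (V : lmodType K) (f : seq E -> V) :
  gsymmetric gr f -> tsymmetric (fun t => f (unzip2 t)).
Proof.
move=> fS t1 t2 [p x] [q y]; rewrite /homog all_cat => /and4P[_ xp yq _].
by rewrite /unzip2 !map_cat; apply: fS.
Qed.

(** The projection of a homogeneous vector to a degree other than its label is 0, so a single term
    of each sum can survive. *)
Lemma hom_extE phi t : tmultilinear phi -> homog gr t ->
  hom_ext gr phi (unzip2 t) = phi t.
Proof.
elim: t phi => [|[i x] t IH] phi //= phiM /andP[xi ht].
have phi0 j : j != i -> hom_ext gr (fun t' => phi ((j, hproj gr j x) :: t')) (unzip2 t) = 0.
  move=> /negbTE ji; rewrite (hproj_homog _ xi) ji -[RHS](hom_ext0 (unzip2 t)).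
  by apply: eq_hom_ext => t' _ _; apply: (tmultilinear0 [::]).
have [is_|iNs] := boolP (i \in supp gr).
  rewrite (bigD1_seq i) ?supp_uniq //= big1 => [|j ji]; last exact: phi0.
  rewrite addr0 (hproj_homog _ xi) eqxx (IH (fun t => phi ((i, x) :: t))) //.
  exact: tmultilinear_cons.
(* A label outside [supp gr] forces the vector to be 0, and then both sides vanish. *)
have -> : x = 0 by apply/eqP; rewrite -memv0 -(piece_out iNs).
rewrite (tmultilinear0 [::]) // big_seq big1 // => j js.
rewrite linear0 -[RHS](hom_ext0 (unzip2 t)).
by apply: eq_hom_ext => t' _ _; apply: (tmultilinear0 [::]).
Qed.

Lemma multilinear_hom_ext phi : tmultilinear phi -> multilinear (hom_ext gr phi).
Proof.
move=> phiM s1 s2 a x y; rewrite !hom_ext_cat -hom_ext_linear.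
apply: eq_hom_ext => t1 _ _ /=; rewrite scaler_sumr -big_split.
apply: eq_bigr => i _ /=; rewrite -hom_ext_linear linearP.
by apply: eq_hom_ext => t2 _ _; apply: phiM.
Qed.

Lemma gsymmetric_hom_ext phi :
  tmultilinear phi -> tsymmetric phi -> gsymmetric gr (hom_ext gr phi).
Proof.
move=> phiM phiS s1 s2 p q x y xp yq; rewrite !hom_ext_cat.
rewrite -[RHS]addr0 -[in RHS](hom_ext0 s1) -hom_ext_linear.
apply: eq_hom_ext => t1 ht1 _ /=; rewrite addr0 exchange_big scaler_sumr.
apply: eq_bigr => j _; rewrite scaler_sumr; apply: eq_bigr => i _ /=.
rewrite -[RHS]addr0 -[in RHS](hom_ext0 s2) -hom_ext_linear.
apply: eq_hom_ext => t2 ht2 _; rewrite addr0.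
rewrite (hproj_homog _ xp) (hproj_homog _ yq).
have [->|_] := eqVneq i p; last first.
  rewrite tmultilinear0 // -cat_rcons tmultilinear0 ?scaler0 //.
have [->|_] := eqVneq j q; last first.
  by rewrite -cat_rcons !tmultilinear0 ?scaler0.
by apply: phiS; move: ht1 ht2; rewrite /homog all_cat /= xp yq => -> ->.
Qed.

Lemma hom_ext_multilinear (f : func E) s :
  multilinear f -> hom_ext gr (fun t => f (unzip2 t)) s = f s.
Proof.
move=> fM; suff H s1 : hom_ext gr (fun t => f (s1 ++ unzip2 t)) s = f (s1 ++ s).
  exact: (H [::]).
elim: s s1 => [|x s IH] s1 //=.
transitivity (\sum_(i <- supp gr) f (s1 ++ hproj gr i x :: s)).
  apply: eq_bigr => i _; rewrite -cat_rcons -IH.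
  by apply: eq_hom_ext => t _ _; rewrite cat_rcons.
rewrite -[in RHS](sum_hproj x); elim: (supp gr) => [|i r IHr].
  by rewrite !big_nil multilinear0.
by rewrite !big_cons IHr -{2}[hproj gr i x]scale1r fM scale1r.
Qed.

Lemma eq_multilinear (f g : func E) : multilinear f -> multilinear g ->
  (forall t, homog gr t -> f (unzip2 t) = g (unzip2 t)) -> f = g.
Proof.
move=> fM gM fg; apply: funext => s.
rewrite -(hom_ext_multilinear s fM) -(hom_ext_multilinear s gM).
by apply: eq_hom_ext => t ht _; apply: fg.
Qed.

End HomogeneousExtension.

(** * Multilinearity and graded symmetry of unshuffle sums *)

Section UnshuffleForms.

Variables (K : fieldType) (E : vectType K) (gr : grading E) (V : lmodType K).
Implicit Types (t u v : seq (int * E)).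
Implicit Type Phi : seq (int * E) -> seq (int * E) -> V.

Lemma tmultilinear_unsh Phi :
    (forall v, tmultilinear (Phi ^~ v)) -> (forall u, tmultilinear (Phi u)) ->
  tmultilinear (unsh Phi).
Proof.
move=> Hl Hr t1; elim: t1 Phi Hl Hr => [|z t1 IH] Phi Hl Hr t2 i a x y /=.
  rewrite scalerDr [RHS]addrACA -!(unshZ a).
  congr (_ + _); rewrite -unshD; apply: eq_unsh => u v _.
    exact: (Hl v [::]).
  by rewrite (Hr u [::]) scalerDr !scalerA mulrC.
rewrite !IH ?scalerDr; first exact: addrACA; move=> w.
- by move=> u1 u2 j b x' y' /=; rewrite !tdeg_cat !tdeg_cons Hl scalerDr !scalerA mulrC.
- move=> u1 u2 j b x' y' /=.
  by rewrite (Hr w (z :: u1)) scalerDr !scalerA mulrC.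
- by move=> u1; apply: (Hl w (z :: u1)).
- exact: Hr.
Qed.

Lemma tsymmetric_unsh Phi :
    (forall v, homog gr v -> tsymmetric gr (Phi ^~ v)) ->
    (forall u, homog gr u -> tsymmetric gr (Phi u)) ->
  tsymmetric gr (unsh Phi).
Proof.
move=> Hl Hr t1 t2 x y; apply: unsh_sym => [u1 u2 v hu hv | u v1 v2 hu hv].
  exact: Hl.
exact: Hr.
Qed.

Lemma tsymmetric_move (f : seq (int * E) -> V) t u x v :
    tsymmetric gr f -> homog gr (t ++ u ++ x :: v) ->
  f (t ++ u ++ x :: v) = (-1) ^ (x.1 * tdeg u) *: f (t ++ x :: u ++ v).
Proof.
move=> fS; elim: u t => [|y u IH] t /= ht; first by rewrite tdeg_nil mulr0 scale1r.
rewrite -cat_rcons IH ?cat_rcons //.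
rewrite fS; first by rewrite scalerA tdeg_cons; congr (_ *: _); signz.
move: ht; rewrite /homog !all_cat /= !all_cat /=.
by case/and5P=> -> -> -> -> ->.
Qed.

End UnshuffleForms.

(** * Functions and their product *)

Section Functions.

Variables (K : fieldType) (E : vectType K) (gr : grading E).
Implicit Types (s : seq E) (t u v : seq (int * E)) (F G H : func E).

Lemma perm_size_cat (T : eqType) (u v t : seq T) :
  perm_eq (u ++ v) t -> (size u + size v)%N = size t.
Proof. by move=> /perm_size; rewrite size_cat. Qed.

Lemma perm_homog u v t :
  perm_eq (u ++ v) t -> homog gr t -> homog gr u /\ homog gr v.
Proof.
by rewrite /homog => /perm_all <-; rewrite all_cat => /andP[].
Qed.

Lemma perm_tdeg_cat u v t : perm_eq (u ++ v) t -> tdeg t = tdeg u + tdeg v.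
Proof. by move=> /perm_tdeg <-; rewrite tdeg_cat. Qed.

Lemma multilinear_lin a F G :
  multilinear F -> multilinear G -> multilinear (fun s => a *: F s + G s).
Proof.
move=> FM GM s1 s2 b x y; rewrite FM GM !scalerDr addrACA.
by rewrite !scalerA (mulrC a b).
Qed.

Lemma multilinear_sum (I : Type) (r : seq I) (F : I -> func E) :
  (forall i, multilinear (F i)) -> multilinear (fun s => \sum_(i <- r) F i s).
Proof.
move=> FM s1 s2 a x y; rewrite scaler_sumr -big_split.
by apply: eq_bigr => i _; apply: FM.
Qed.

Lemma multilinear_size (c : nat -> K) F :
  multilinear F -> multilinear (fun s => c (size s) *: F s).
Proof.
move=> FM s1 s2 a x y; rewrite FM scalerDr !size_cat !scalerA mulrC.
by rewrite -!scalerA.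
Qed.

Lemma ufunctions_lin a F G :
  ufunctions gr F -> ufunctions gr G -> ufunctions gr (fun s => a *: F s + G s).
Proof.
move=> [FM FS] [GM GS]; split; first exact: multilinear_lin.
move=> s1 s2 p q x y xp yq; rewrite (FS _ _ _ _ _ _ xp yq) (GS _ _ _ _ _ _ xp yq).
by rewrite scalerDr !scalerA (mulrC a).
Qed.

Lemma ufunctions_size (c : nat -> K) F :
  ufunctions gr F -> ufunctions gr (fun s => c (size s) *: F s).
Proof.
move=> [FM FS]; split; first exact: multilinear_size.
move=> s1 s2 p q x y xp yq; rewrite (FS _ _ _ _ _ _ xp yq).
by rewrite !size_cat !scalerA mulrC.
Qed.

Lemma functions_lin a F G :
  functions gr F -> functions gr G -> functions gr (fun s => a *: F s + G s).
Proof.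
move=> [Fu F0] [Gu G0]; split; first exact: ufunctions_lin.
by rewrite F0 G0 scaler0 addr0.
Qed.

Lemma ufunctions_of_const c : ufunctions gr (of_const c).
Proof.
split=> [s1 s2 a x y | s1 s2 p q x y _ _]; case: s1 => *; rewrite /= ?scaler0 ?addr0 //.
Qed.

Lemma functions_of_const0 : functions gr (of_const 0).
Proof. by split; first exact: ufunctions_of_const. Qed.

Lemma functions_of_dual xi : functions gr (of_dual xi).
Proof.
split=> //; split=> [s1 s2 a x y | s1 s2 p q x y _ _].
  case: s1 => [|x1 [|x2 s1]]; case: s2 => [|y1 s2] /=; rewrite ?scaler0 ?addr0 //.
  exact: linearP.
by case: s1 => [|x1 [|x2 s1]]; rewrite /= scaler0.
Qed.

Lemma has_degree_of_dual i xi : dual_homog gr i xi -> has_degree gr i (of_dual xi).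
Proof.
move=> xiH [|[p x] [|? ?]] //=; rewrite andbT tdeg_cons tdeg_nil addr0.
exact: xiH.
Qed.

(** The interior product by [e]. With the Koszul rule used in [gmul], it is insertion in the last
    place that gives a left derivation. *)
Definition contract (e : E) F : func E := fun s => F (rcons s e).

Lemma ufunctions_contract p e F : e \in gr p ->
  ufunctions gr F -> ufunctions gr (contract e F).
Proof.
move=> ep [FM FS]; split=> [s1 s2 a x y | s1 s2 q r x y xq yr].
  by rewrite /contract !rcons_cat; apply: FM.
by rewrite /contract !rcons_cat; apply: FS.
Qed.

Definition gmul_form F G : seq (int * E) -> K^o :=
  unsh (fun u v => (-1) ^ (tdeg u * tdeg v) *: (F (unzip2 u) * G (unzip2 v) : K^o)).

Lemma gmul_hom_ext F G : gmul gr F G = hom_ext gr (gmul_form F G).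
Proof.
apply: funext => s; apply: eq_hom_ext => t _ _; rewrite /gmul_form -sum_Sh_unsh.
by apply: eq_bigr => i _; apply: eq_bigr => sigma _; rewrite -!mulrA.
Qed.

Lemma tmultilinear_gmul_form F G :
  multilinear F -> multilinear G -> tmultilinear (gmul_form F G).
Proof.
move=> FM GM; apply: tmultilinear_unsh => w t1 t2 i a x y.
  rewrite !tdeg_cat !tdeg_cons (multilinear_unzip2 FM).
  by rewrite /GRing.scale /=; ring.
rewrite !tdeg_cat !tdeg_cons (multilinear_unzip2 GM).
by rewrite /GRing.scale /=; ring.
Qed.

Lemma gmulE F G t : multilinear F -> multilinear G -> homog gr t ->
  gmul gr F G (unzip2 t) = gmul_form F G t.
Proof.
by move=> FM GM ht; rewrite gmul_hom_ext hom_extE //; apply: tmultilinear_gmul_form.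
Qed.

Lemma ufunctions_gmul F G :
  ufunctions gr F -> ufunctions gr G -> ufunctions gr (gmul gr F G).
Proof.
move=> [FM FS] [GM GS]; have FGM := tmultilinear_gmul_form FM GM.
rewrite gmul_hom_ext; split; first exact: multilinear_hom_ext.
apply: gsymmetric_hom_ext => //; apply: tsymmetric_unsh => w hw t1 t2 x y ht.
  rewrite (gsymmetric_unzip2 FS) // !tdeg_cat !tdeg_cons (addrCA x.1).
  by rewrite /GRing.scale /=; ring.
rewrite (gsymmetric_unzip2 GS) // !tdeg_cat !tdeg_cons (addrCA x.1).
by rewrite /GRing.scale /=; ring.
Qed.

Lemma gmul_nil F G : gmul gr F G [::] = F [::] * G [::].
Proof. by rewrite gmul_hom_ext /gmul_form /= tdeg_nil mulr0 expr0z scale1r. Qed.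

Lemma functions_gmul F G :
  functions gr F -> functions gr G -> functions gr (gmul gr F G).
Proof.
by move=> [Fu F0] [Gu G0]; split; [exact: ufunctions_gmul | rewrite gmul_nil F0 mul0r].
Qed.

(** A linear form consumes one argument, so [G] is only evaluated in smaller arity; this feeds the
    induction on arity for derivations. *)
Lemma eq_gmul_dual xi G H s :
    (forall s', (size s' < size s)%N -> G s' = H s') ->
  gmul gr (of_dual xi) G s = gmul gr (of_dual xi) H s.
Proof.
move=> GH; rewrite !gmul_hom_ext; apply: eq_hom_ext => t ht st.
apply: eq_unsh => u v uv; case: u uv => [|x [|? ?]] uv /=; rewrite ?mul0r //.
by rewrite GH // size_map -st -(perm_size_cat uv) add1n.
Qed.

(** The letter [e], last in the sequence, goes to the end of one of the two blocks. In the first one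
    the sign of crossing [v] cancels the change of the Koszul sign; in the second one that change is
    the Leibniz sign. *)
Lemma contract_gmul p e n F G : e \in gr p ->
    ufunctions gr F -> ufunctions gr G -> has_degree gr n F ->
  contract e (gmul gr F G) = fun s =>
    gmul gr (contract e F) G s + (-1) ^ (p * n) *: gmul gr F (contract e G) s.
Proof.
move=> ep Fu Gu Fn.
have [eFu eGu] := (ufunctions_contract ep Fu, ufunctions_contract ep Gu).
have [[FM _] [GM _]] := (Fu, Gu).
have [[eFM _] [eGM _]] := (eFu, eGu).
apply: (eq_multilinear (gr := gr)) => [||t ht].
- by have [] := ufunctions_contract ep (ufunctions_gmul Fu Gu).
- have M := multilinear_lin ((-1) ^ (p * n)) (proj1 (ufunctions_gmul Fu eGu))
    (proj1 (ufunctions_gmul eFu Gu)).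
  by move=> s1 s2 a x y; rewrite ![gmul _ _ _ _ + _]addrC; apply: M.
rewrite /contract -[rcons _ e]/(rcons (unzip2 t) (p, e).2) -map_rcons !gmulE //; last first.
  by rewrite /homog all_rcons /= ep; apply: ht.
rewrite /gmul_form unsh_rcons; congr (_ + _).
  apply: eq_unsh => u v uv; rewrite tdeg_rcons scalerA /unzip2 map_rcons.
  by congr (_ *: _); signz.
rewrite -unshZ; apply: eq_unsh => u v uv; rewrite tdeg_rcons [in RHS]scalerA /unzip2 map_rcons.
have [hu hv] := perm_homog uv ht.
(* The degree of [F] lets [tdeg u] be replaced by [- n] in the sign. *)
have [un|un] := eqVneq (tdeg u) (- n); last by rewrite Fn // /GRing.scale /=; ring.
by congr (_ *: _); rewrite un; signz.
Qed.

(** The counting behind Euler's formula: pulling any one letter to the front gives [f t] back, since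
    graded symmetry of [f] absorbs the sign. *)
Lemma unsh_size1 (f : seq (int * E) -> K^o) t : tsymmetric gr f -> homog gr t ->
  unsh (fun u v => (size u == 1)%:R *: f (u ++ v)) t = (size t)%:R *: f t.
Proof.
elim: t f => [|x t IH] f fS ht /=; first by rewrite !scale0r.
rewrite addrC -natr1 scalerDl scale1r; congr (_ + _); last first.
  rewrite -[RHS](unsh_nill (fun v => f (x :: v))).
  by apply: eq_unsh => -[|y u] v _ /=; rewrite ?scale1r ?scale0r.
rewrite -(IH (fun t => f (x :: t))).
- apply: eq_unsh => u v uv; case: eqP => u1; last by rewrite !scale0r scaler0.
  rewrite !scale1r -[u ++ _]cat0s (tsymmetric_move (gr := gr) (t := [::])) //.
    by rewrite scalerA signzK scale1r.
  by move: ht; rewrite /homog /= -(perm_all _ uv) !all_cat /=; case/and3P=> -> -> ->.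
- by move=> t1 t2 y z h; apply: (fS (x :: t1)) => /=; move: ht => /andP[-> _].
- by case/andP: ht.
Qed.

End Functions.

(** * Frames and uniqueness of derivations *)

Section Frames.

Variables (K : numFieldType) (E : vectType K) (gr : grading E).
Implicit Types (F G : func E) (A : func E -> Prop).

(** A homogeneous resolution of the identity. This covers both the basis assembled from the pieces
    of [gr] and the vectors dual to a given basis of forms; [d] records the degrees of the forms,
    opposite to those of the vectors. *)
Record frame (I : finType) (d : I -> int) (xi : I -> 'Hom(E, K^o))
    (e : I -> E) : Prop := Frame {
  frame_dual : forall j, dual_homog gr (d j) (xi j);
  frame_mem : forall j, e j \in gr (- d j);
  frame_sum : forall x, \sum_j xi j x *: e j = x }.

(* By Euler's formula F is F^(0) + F^(1) + sum_j xi^j . (euler_part (e j) F)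
   for any frame (xi, e), where the removal of the constant term makes
   euler_part (e j) F a function. *)
Definition euler_part (e : E) F : func E :=
  fun s => ((size s != 0)%:R / (size s).+1%:R) *: contract e F s.

Lemma functions_euler_part p e F : e \in gr p ->
  ufunctions gr F -> functions gr (euler_part e F).
Proof.
move=> ep Fu; split; last by rewrite /euler_part /= mul0r scale0r.
by apply: (ufunctions_size (fun k => (k != 0)%:R / k.+1%:R)); apply: ufunctions_contract ep Fu.
Qed.

Variables (I : finType) (d : I -> int) (xi : I -> 'Hom(E, K^o)) (e : I -> E).
Hypothesis fr : frame d xi e.

Lemma frame_linear (V : lmodType K) (f : E -> V) x :
  linear f -> \sum_j xi j x *: f (e j) = f x.
Proof.
move=> fL; rewrite -[in RHS](frame_sum fr x).
have f0 : f 0 = 0 by rewrite -(addNr 0) -scaleN1r fL scaleN1r addNr.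
elim: (index_enum I) => [|j r IH]; first by rewrite !big_nil f0.
by rewrite !big_cons fL IH.
Qed.

Lemma frame_multilinear (V : lmodType K) (f : seq E -> V) s1 s2 x :
  multilinear f -> \sum_j xi j x *: f (s1 ++ e j :: s2) = f (s1 ++ x :: s2).
Proof.
move=> fM; apply: (frame_linear (f := fun y => f (s1 ++ y :: s2))) => a y z.
exact: fM.
Qed.

(** In arity k > 1 the products of [xi j] with [contract (e j) F] add up to k times [F], and
    [euler_part] divides by k, which is invertible in characteristic 0. Arities 0 and 1 are covered
    by the other two terms. *)
Lemma euler_decomposition F : ufunctions gr F ->
  F = fun s => of_const (F [::]) s +
    \sum_j (F [:: e j] *: of_dual (xi j) s
            + gmul gr (of_dual (xi j)) (euler_part (e j) F) s).
Proof.
move=> Fu; have [FM FS] := Fu.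
have Pu j := proj1 (functions_euler_part (frame_mem fr j) Fu).
have Xu j := proj1 (functions_of_dual gr (xi j)).
have XPu j := ufunctions_lin (F [:: e j]) (Xu j) (ufunctions_gmul (Xu j) (Pu j)).
apply: (eq_multilinear (gr := gr)) => // [|t ht].
  have M := multilinear_lin 1 (proj1 (ufunctions_of_const gr (F [::])))
    (multilinear_sum (index_enum I) (fun j => proj1 (XPu j))).
  by move=> s1 s2 a x y; have := M s1 s2 a x y; rewrite !scale1r.
rewrite big_split /=.
have -> : \sum_j gmul gr (of_dual (xi j)) (euler_part (e j) F) (unzip2 t) =
    ((1 < size t)%:R / (size t)%:R) *: ((size t)%:R *: F (unzip2 t)).
  rewrite -(unsh_size1 (gsymmetric_unzip2 FS) ht) -unshZ.
  under eq_bigr => j _ do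
    rewrite (gmulE (proj1 (Xu j)) (proj1 (Pu j)) ht) /gmul_form.
  rewrite -unsh_sum; apply: eq_unsh => u v uv.
  have [hu hv] := perm_homog uv ht.
  case: u uv hu => [|[p x] [|? ?]] uv hu; last 2 first.
  - rewrite /= tdeg_cons tdeg_nil addr0 /euler_part size_map.
    have <- := perm_size_cat uv; rewrite add1n ltnS lt0n scale1r.
    transitivity (((size v != 0)%:R / (size v).+1%:R) *: ((-1) ^ (p * tdeg v) *:
       \sum_j xi j x *: F (unzip2 v ++ [:: e j]))).
      rewrite !scaler_sumr; apply: eq_bigr => j _; rewrite /contract cats1.
      by rewrite /GRing.scale /=; ring.
    (* The frame restores [x] as last argument of [F]; moving it to the front costs exactly the sign
       of the product. *)
    rewrite frame_multilinear //; congr (_ *: _).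
    have := tsymmetric_move (t := [::]) (v := [::]) (x := (p, x))
      (u := v) (gsymmetric_unzip2 FS).
    rewrite /= cats0 /unzip2 map_cat /homog all_cat => ->.
      by rewrite scalerA signzK scale1r.
    by move: hu hv; rewrite /homog /= => -> ->.
  - by rewrite /= scale0r scaler0 big1 // => j _; rewrite mul0r scaler0.
  - by rewrite /= scale0r scaler0 big1 // => j _; rewrite mul0r scaler0.
case: t ht => [|[p x] [|y t]] ht /=.
- by rewrite mul0r scale0r big1 ?addr0 // => j _; rewrite scaler0.
- rewrite mul0r scale0r addr0 add0r -(frame_multilinear [::] [::] x FM).
  by apply: eq_bigr => j _; rewrite /GRing.scale /= mulrC.
- rewrite add0r big1 ?add0r => [|j _]; last by rewrite scaler0.
  by rewrite mul1r scalerA mulVf ?scale1r // pnatr_eq0.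
Qed.

Definition linear_on A (D : func E -> func E) : Prop :=
  forall a F G, A F -> A G ->
    D (fun s => a *: F s + G s) =1 (fun s => a *: D F s + D G s).

Lemma linear_on_sum A D F (G : I -> func E) r :
    (forall a F G, A F -> A G -> A (fun s => a *: F s + G s)) ->
    linear_on A D -> A F -> (forall j, A (G j)) ->
  A (fun s => F s + \sum_(j <- r) G j s) /\
  D (fun s => F s + \sum_(j <- r) G j s) =1
    (fun s => D F s + \sum_(j <- r) D (G j) s).
Proof.
move=> A_lin D_lin AF AG; elim: r => [|j r [IH1 IH2]].
  have -> : (fun s => F s + \sum_(j <- [::]) G j s) = F.
    by apply: funext => s; rewrite big_nil addr0.
  by split=> // s; rewrite big_nil addr0.
have -> : (fun s => F s + \sum_(k <- j :: r) G k s) =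
    (fun s => 1 *: G j s + (F s + \sum_(k <- r) G k s)).
  by apply: funext => s; rewrite big_cons addrCA scale1r.
split=> [|s]; first exact: A_lin.
by rewrite D_lin // IH2 scale1r big_cons addrCA.
Qed.

(* The Euler decomposition reduces the values of D F in arity k to those in
   arity < k of D on other functions; so no continuity of D is needed. *)
Lemma derivation_unique A i D1 D2 :
    (forall F, A F -> ufunctions gr F) ->
    (forall F, A F -> A (of_const (F [::]))) ->
    (forall a F G, A F -> A G -> A (fun s => a *: F s + G s)) ->
    (forall F G, A F -> A G -> A (gmul gr F G)) ->
    (forall F, functions gr F -> A F) ->
    linear_on A D1 -> linear_on A D2 ->
    (forall j G, A G -> D1 (gmul gr (of_dual (xi j)) G) =1
       (fun s => gmul gr (D1 (of_dual (xi j))) G s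
          + (-1) ^ (i * d j) *: gmul gr (of_dual (xi j)) (D1 G) s)) ->
    (forall j G, A G -> D2 (gmul gr (of_dual (xi j)) G) =1
       (fun s => gmul gr (D2 (of_dual (xi j))) G s
          + (-1) ^ (i * d j) *: gmul gr (of_dual (xi j)) (D2 G) s)) ->
    (forall c, A (of_const c) -> D1 (of_const c) =1 D2 (of_const c)) ->
    (forall j, D1 (of_dual (xi j)) =1 D2 (of_dual (xi j))) ->
  forall F, A F -> D1 F =1 D2 F.
Proof.
move=> A_u A_c A_lin A_mul A_f lin1 lin2 leib1 leib2 eqc eqx F AF s.
have [k] := ubnP (size s); elim: k F AF s => // k IH F AF s ltk.
have AX j : A (of_dual (xi j)) by apply/A_f/functions_of_dual.
have AP j : A (euler_part (e j) F).
  by apply/A_f/(functions_euler_part (frame_mem fr j))/A_u.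
have AXP j := A_mul _ _ (AX j) (AP j).
rewrite {1 2}(euler_decomposition (A_u F AF)).
have [_ ->] := linear_on_sum (index_enum I) A_lin lin1 (A_c F AF)
  (fun j => A_lin (F [:: e j]) _ _ (AX j) (AXP j)).
have [_ ->] := linear_on_sum (index_enum I) A_lin lin2 (A_c F AF)
  (fun j => A_lin (F [:: e j]) _ _ (AX j) (AXP j)).
rewrite eqc; last exact: A_c.
congr (_ + _); apply: eq_bigr => j _.
rewrite lin1 // lin2 // leib1 // leib2 // (funext (eqx j)).
congr (_ + (_ + _ *: _)); apply: eq_gmul_dual => s' lts.
by apply: IH => //; apply: leq_trans lts _.
Qed.

End Frames.

Arguments frame_dual {K E gr I d xi e} _ j.

(** * Supertraces *)

Section Supertraces.

Variables (K : numFieldType) (E : vectType K) (gr : grading E).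

Lemma lfunZ (V : vectType K) (f : 'Hom(E, V)) a x : f (a *: x) = a *: f x.
Proof. exact: linearZ. Qed.

(** Labels of the basis of [E] obtained by joining the bases of its pieces, which provides a frame
    without any choice. *)
Definition std_index : finType :=
  {k : 'I_(size (supp gr)) & 'I_(\dim (gr (tnth (in_tuple (supp gr)) k)))}.

Definition std_deg (p : std_index) : int := tnth (in_tuple (supp gr)) (tag p).

Definition std_vec (p : std_index) : E := (vbasis (gr (std_deg p)))`_(tagged p).

Definition std_form (p : std_index) : 'Hom(E, K^o) :=
  linfun (rT := K^o) (coord (vbasis (gr (std_deg p))) (tagged p) \o hproj gr (std_deg p)).

Lemma std_formE p x :
  std_form p x = coord (vbasis (gr (std_deg p))) (tagged p) (hproj gr (std_deg p) x).
Proof. by rewrite lfunE. Qed.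

Lemma std_frame : frame gr (fun p => - std_deg p) std_form std_vec.
Proof.
split=> [p j x xj | p | x].
- by rewrite opprK std_formE (hproj_homog _ xj) eq_sym => /negbTE->; rewrite linear0.
- by rewrite opprK; apply/vbasis_mem/mem_nth; rewrite size_tuple.
- pose r := in_tuple (supp gr).
  pose F k (j : 'I_(\dim (gr (tnth r k)))) :=
    coord (vbasis (gr (tnth r k))) j (hproj gr (tnth r k) x) *: (vbasis (gr (tnth r k)))`_j.
  transitivity (\sum_(p : std_index) F (tag p) (tagged p)).
    by apply: eq_bigr => p _; rewrite std_formE.
  rewrite -(sig_big_dep xpredT (fun _ => xpredT) F) -[RHS](sum_hproj gr) (big_tnth _ _ (supp gr)).
  by apply: eq_bigr => k _; rewrite -coord_vbasis ?mem_hproj.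
Qed.

(** * Graded cyclicity of the supertrace *)

Section LinearMaps.

Variables (I : finType) (d : I -> int) (xi : I -> 'Hom(E, K^o)) (e : I -> E).
Hypothesis fr : frame gr d xi e.

(** The supertrace read in a frame: [e j] has degree [- d j], of the same parity as [d j]. *)
Definition frame_str (f : E -> E) : K^o := \sum_j (-1) ^ d j *: xi j (f (e j)).

(** Both sides expand into the same products of matrix entries, and an entry of [g] vanishes unless
    the degrees differ by [q], which fixes the ratio of the signs. For [f] of degree [- q] the usual
    sign (-1)^(|f||g|) is indeed (-1)^q. *)
Lemma frame_str_swap (f g : E -> E) q : linear f -> linear g ->
    (forall i x, x \in gr i -> g x \in gr (i + q)) ->
  frame_str (f \o g) = (-1) ^ q *: frame_str (g \o f).
Proof.
move=> fL gL gq; rewrite /frame_str scaler_sumr.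
transitivity (\sum_j \sum_k (-1) ^ d j *: (xi k (g (e j)) *: xi j (f (e k)))).
  apply: eq_bigr => j _; rewrite -scaler_sumr; congr (_ *: _) => /=.
  rewrite -(frame_linear fr (g (e j)) fL) linear_sum.
  by apply: eq_bigr => k _; rewrite /= lfunZ.
rewrite exchange_big; apply: eq_bigr => k _ /=.
rewrite -(frame_linear fr (f (e k)) gL) linear_sum !scaler_sumr.
apply: eq_bigr => j _; rewrite /= lfunZ /=.
have [jk|jk] := eqVneq (- d j + q) (- d k); last first.
  rewrite (frame_dual fr k _ _ (gq _ _ (frame_mem fr j)) jk).
  by rewrite scale0r !scaler0.
rewrite /GRing.scale /= [in RHS]mulrA signzM [xi j _ * _]mulrC -[d k]opprK -jk.
by congr (_ * _); signz.
Qed.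

End LinearMaps.

(** Expanding the vectors of one frame in the other gives a common double sum; only indices of equal
    degree contribute, so the signs agree. *)
Lemma frame_str_indep (I J : finType) d (xi : I -> 'Hom(E, K^o)) e d' 
    (eta : J -> 'Hom(E, K^o)) e' (f : E -> E) :
    frame gr d xi e -> frame gr d' eta e' -> linear f ->
  frame_str d xi e f = frame_str d' eta e' f.
Proof.
move=> fr fr' fL; rewrite /frame_str.
transitivity (\sum_i \sum_j (-1) ^ d i *: (eta j (e i) *: xi i (f (e' j)))).
  apply: eq_bigr => i _; rewrite -scaler_sumr; congr (_ *: _).
  rewrite -(frame_linear fr' (e i) fL) linear_sum.
  by apply: eq_bigr => k _; rewrite /= lfunZ.
rewrite exchange_big; apply: eq_bigr => j _ /=.
rewrite -[in RHS](frame_sum fr (f (e' j))) linear_sum scaler_sumr.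
apply: eq_bigr => i _; rewrite /= lfunZ /=.
have [ij|ij] := eqVneq (- d i) (- d' j); last first.
  by rewrite (frame_dual fr' j _ _ (frame_mem fr i) ij) scale0r !scaler0.
by rewrite (oppr_inj ij) /GRing.scale /= [xi i _ * _]mulrC.
Qed.

(** By independence of the frame the standard one suffices; there the terms are the diagonal entries
    of [f] on each piece, as [f] preserves the pieces. *)
Lemma Str_frame (I : finType) d (xi : I -> 'Hom(E, K^o)) e (f : E -> E) :
    frame gr d xi e -> linear f -> (forall i x, x \in gr i -> f x \in gr i) ->
  Str gr f = frame_str d xi e f.
Proof.
move=> fr fL f0; rewrite (frame_str_indep fr std_frame fL) /frame_str /Str (big_tnth _ _ (supp gr)).
pose r := in_tuple (supp gr).
pose F k (j : 'I_(\dim (gr (tnth r k)))) : K :=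
  (-1) ^ tnth r k * coord (vbasis (gr (tnth r k))) j (f (vbasis (gr (tnth r k)))`_j).
transitivity (\sum_k \sum_j F k j).
  by apply: eq_bigr => k _; rewrite mulr_sumr.
rewrite (sig_big_dep xpredT (fun _ => xpredT) F); apply: eq_bigr => p _.
rewrite std_formE (hproj_homog _ (j := std_deg p)) ?eqxx.
  by congr (_ * _); apply: eq_signz; rewrite oddzN.
by apply/f0/vbasis_mem/mem_nth; rewrite size_tuple.
Qed.

(** * Vectors dual to a homogeneous basis of forms *)

Section DualBasis.

Variables (n : nat) (d : 'I_n -> int) (xi : n.-tuple 'Hom(E, K^o)).
Hypothesis xiB : dual_basis_homog gr d xi.

(** Expanding each [std_form p] in the basis [xi] and collecting the coefficients of [xi j] gives
    the inner sum; the projection makes homogeneity hold by construction. *)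
Definition dual_vec (j : 'I_n) : E :=
  hproj gr (- d j) (\sum_p coord xi j (std_form p) *: std_vec p).

Lemma dual_frame : frame gr d (tnth xi) dual_vec.
Proof.
have [xi_basis xiH] := xiB; split=> // [j | x]; first exact: mem_hproj.
have sum_y y : \sum_j tnth xi j y *: (\sum_p coord xi j (std_form p) *: std_vec p) = y.
  under eq_bigr => j _ do rewrite scaler_sumr.
  rewrite exchange_big -[RHS](frame_sum std_frame y); apply: eq_bigr => p _ /=.
  have := coord_basis xi_basis (memvf (std_form p)) => {2}->.
  rewrite sum_lfunE scaler_suml; apply: eq_bigr => j _.
  by rewrite lfunE /= scalerA (tnth_nth 0) mulrC.
rewrite -[RHS](sum_hproj gr) -[X in \sum_j tnth xi j X *: _](sum_hproj gr).
under eq_bigr => j _ do rewrite linear_sum scaler_suml.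
rewrite exchange_big; apply: eq_bigr => p _ /=.
have zp := mem_hproj gr p x; set z := hproj gr p x in zp *.
(* Projecting the resolution [sum_y] of [z] to degree [p] yields the vectors [dual_vec j] with
   [- d j = p]; for the other [j] the coefficient [tnth xi j z] is 0. *)
have -> : z = hproj gr p z by rewrite (hproj_homog _ zp) eqxx.
rewrite -[in RHS](sum_y z) linear_sum; apply: eq_bigr => j _.
rewrite /= lfunZ /= (hproj_homog _ zp) eqxx.
have [<- //|pj] := eqVneq (- d j) p.
by rewrite (xiH j p z zp) 1?eq_sym // !scale0r.
Qed.

(** The frame expands [tnth xi k] with these values as coefficients, and the forms are free. *)
Lemma dual_vecE j k : tnth xi k (dual_vec j) = (j == k)%:R.
Proof.
have [/andP[_ xi_free] _] := xiB.
have xik : tnth xi k = \sum_i tnth xi k (dual_vec i) *: tnth xi i.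
  apply/lfunP => x; rewrite sum_lfunE -[in LHS](frame_sum dual_frame x) linear_sum.
  by apply: eq_bigr => i _; rewrite /= lfunZ lfunE /= /GRing.scale /= mulrC.
have cx i : coord xi j (tnth xi i) = (i == j)%:R.
  by rewrite (tnth_nth 0) coord_free.
have := congr1 (coord xi j) xik; rewrite linear_sum (bigD1 j) //= big1 => [|i].
  by rewrite addr0 linearZ /= !cx eqxx /GRing.scale /= mulr1 eq_sym => <-.
by move=> /negbTE ij; rewrite linearZ /= cx ij /GRing.scale /= mulr0.
Qed.

End DualBasis.

End Supertraces.

(** * The vector field Q *)

Section VectorField.

Variables (K : numFieldType) (E : vectType K) (gr : grading E) (l : seq E -> E).
Hypothesis Hl : Linfty gr l.
Implicit Types (F G : func E) (t u v : seq (int * E)).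

(** For [F] of degree n only [tdeg t = - n - 1] matters, so the sign is (-1)^n, as in the definition
    of Q on forms; written with [tdeg t] it makes sense for every [F]. *)
Definition Q_form F : seq (int * E) -> K^o := fun t =>
  (-1) ^ (tdeg t + 1) *: unsh (fun u v => F (l (unzip2 u) :: unzip2 v)) t.

Definition Q_op F : func E := hom_ext gr (Q_form F).

Lemma tmultilinear_Q_form F : multilinear F -> tmultilinear (Q_form F).
Proof.
move=> FM t1 t2 i a x y; rewrite /Q_form !tdeg_cat !tdeg_cons.
rewrite tmultilinear_unsh; first by rewrite scalerDr !scalerA mulrC.
- move=> v u1 u2 j b z w /=; rewrite (multilinear_unzip2 (Linfty_multilinear Hl)).
  exact: (FM [::]).
- by move=> u v1 v2 j b z w /=; rewrite /unzip2 !map_cat; apply: (FM (_ :: _)).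
Qed.

Lemma Q_opE F t : multilinear F -> homog gr t -> Q_op F (unzip2 t) = Q_form F t.
Proof. by move=> FM ht; apply: hom_extE => //; apply: tmultilinear_Q_form. Qed.

Lemma Q_op_linear : linear_on (functions gr) Q_op.
Proof.
move=> a F G _ _ s; rewrite /Q_op -hom_ext_linear; apply: eq_hom_ext => t _ _.
by rewrite /Q_form unshD unshZ scalerDr !scalerA mulrC.
Qed.

Lemma homog_l t : homog gr t -> homog gr [:: (tdeg t + 1, l (unzip2 t))].
Proof. by move=> ht; rewrite /homog /= (Linfty_degree Hl). Qed.

Lemma Q_op_of_dual i xi : dual_homog gr i xi ->
  Q_op (of_dual xi) = fun s => (-1) ^ i *: xi (l s).
Proof.
move=> xiH; apply: funext => s.
have M : multilinear (fun s => (-1) ^ i *: xi (l s) : K^o).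
  move=> s1 s2 a x y; rewrite (Linfty_multilinear Hl) linearP scalerDr.
  by congr (_ + _); rewrite !scalerA mulrC.
rewrite -(hom_ext_multilinear gr s M); apply: eq_hom_ext => t ht _.
rewrite /Q_form -(unsh_nilr (fun t => xi (l (unzip2 t))) t).
have -> : unsh (fun u v => of_dual xi (l (unzip2 u) :: unzip2 v)) t = xi (l (unzip2 t)).
  by rewrite -[RHS](unsh_nilr (fun t => xi (l (unzip2 t)))); apply: eq_unsh => u [].
rewrite unsh_nilr; have [ti|ti] := eqVneq (tdeg t + 1) (- i).
  by congr (_ *: _); rewrite ti; signz.
by rewrite (xiH _ _ (Linfty_degree Hl ht)) // !scaler0.
Qed.

(** The bracket of a block [a] becomes an argument of [F] or of [G]. Coassociativity regroups the
    three blocks accordingly. *)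
Lemma Q_op_gmul n F G : ufunctions gr F -> ufunctions gr G -> has_degree gr n F ->
  Q_op (gmul gr F G) = fun s =>
    gmul gr (Q_op F) G s + (-1) ^ (1 * n) *: gmul gr F (Q_op G) s.
Proof.
move=> [FM FS] [GM GS] Fn.
apply: funext => s; rewrite (gmul_hom_ext gr (Q_op F)) (gmul_hom_ext gr F (Q_op G)).
rewrite [RHS]addrC -hom_ext_linear.
apply: eq_hom_ext => t ht _; rewrite [RHS]addrC {1}/Q_form.
(* [P1] collects the terms with the bracket in [F] and [P2] those with the bracket in [G], where it
   has also crossed [y]. *)
pose P1 (a y z : seq (int * E)) : K^o :=
  (-1) ^ (tdeg t + 1 + (tdeg a + 1 + tdeg y) * tdeg z) *:
    (F (l (unzip2 a) :: unzip2 y) * G (unzip2 z)).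
pose P2 (a y z : seq (int * E)) : K^o :=
  (-1) ^ (tdeg t + 1 + (tdeg a + 1) * tdeg y + tdeg y * (tdeg a + 1 + tdeg z)) *:
    (F (unzip2 y) * G (l (unzip2 a) :: unzip2 z)).
transitivity (unsh (fun a b => unsh (P1 a) b) t + unsh (fun a b => unsh (P2 a) b) t).
  rewrite -unshZ -unshD; apply: eq_unsh => a b ab.
  have [ha hb] := perm_homog ab ht.
  have hab : homog gr ((tdeg a + 1, l (unzip2 a)) :: b).
    by have := homog_l ha; rewrite /homog /= andbT => ->.
  rewrite (gmulE FM GM hab) /gmul_form /= scalerDr -!unshZ.
  congr (_ + _); apply: eq_unsh => y z _; rewrite /P1 /P2 /= ?tdeg_cons;
    rewrite /GRing.scale /= !mulrA; congr (_ * _ * _); by signz.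
congr (_ + _).
  rewrite (unsh_assoc P1); apply: eq_unsh => w z wz.
  have [hw hz] := perm_homog wz ht.
  rewrite Q_opE // /Q_form -scalerAl [unsh _ _ * _]mulrC scalerA -[_ * unsh _ _]/(_ *: unsh _ _).
  rewrite -!unshZ; apply: eq_unsh => a y ay; rewrite /P1.
  have -> := perm_tdeg_cat wz; rewrite (perm_tdeg_cat ay).
  rewrite /GRing.scale /= [G _ * _]mulrC; by congr (_ * _); signz.
rewrite (unsh_assoc P2).
(* Cocommutativity puts [a] after [y], next to [z], so that coassociativity can make [a] and [z] the
   argument of [Q_op gr l G]. *)
transitivity (unsh (fun w z =>
    unsh (fun y a => (-1) ^ (tdeg y * tdeg a) *: P2 a y z) w) t).
  by apply: eq_unsh => w z _; rewrite unsh_swap.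
rewrite -(unsh_assoc (fun y a z => (-1) ^ (tdeg y * tdeg a) *: P2 a y z)) -unshZ.
apply: eq_unsh => y w yw.
have [hy hw] := perm_homog yw ht.
rewrite Q_opE // /Q_form -[F _ * _]/(F _ *: _) -!unshZ.
apply: eq_unsh => a z az; rewrite /P2 (perm_tdeg_cat yw) (perm_tdeg_cat az).
have [yn|yn] := eqVneq (tdeg y) (- n); last by rewrite Fn // /GRing.scale /=; ring.
rewrite /GRing.scale /= yn mul1r.
transitivity ((-1) ^ (n + n * (tdeg a + tdeg z) + tdeg a + tdeg z + 1) *
  (F (unzip2 y) * G (l (unzip2 a) :: unzip2 z)) : K).
  by rewrite mulrA signzM; congr (_ * _); signz.
rewrite [F _ * (_ * _)]mulrCA !mulrA signzM; congr (_ * _ * _); signz.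
Qed.

End VectorField.

(** * Divergence and modular function *)

Section Derivations.

Variables (K : numFieldType) (E : vectType K) (gr : grading E).
Implicit Types (F G : func E) (t u v : seq (int * E)).

Lemma linear_on0 (A : func E -> Prop) D :
  linear_on A D -> A (of_const 0) -> D (of_const 0) =1 fun=> 0.
Proof.
move=> D_lin A0 s; have := D_lin (-1) _ _ A0 A0 s.
have -> : (fun s => -1 *: of_const 0 s + of_const 0 s) = of_const 0 :> func E.
  by apply: funext => s'; rewrite scaleN1r addNr; case: s'.
by rewrite scaleN1r addNr.
Qed.

Lemma gmul_const1l F : multilinear F -> gmul gr (of_const 1) F = F.
Proof.
move=> FM; apply: funext => s; rewrite gmul_hom_ext -[RHS](hom_ext_multilinear gr s FM).
apply: eq_hom_ext => t _ _; rewrite -(unsh_nill (fun t => F (unzip2 t))).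
apply: eq_unsh => -[|y u] v _ /=; last by rewrite mul0r scaler0.
by rewrite tdeg_nil mul0r scale1r mul1r.
Qed.

Lemma gmul_const1r F : multilinear F -> gmul gr F (of_const 1) = F.
Proof.
move=> FM; apply: funext => s; rewrite gmul_hom_ext -[RHS](hom_ext_multilinear gr s FM).
apply: eq_hom_ext => t _ _; rewrite -(unsh_nilr (fun t => F (unzip2 t))).
apply: eq_unsh => u [|y v] _ /=; last by rewrite mulr0 scaler0.
by rewrite tdeg_nil mulr0 scale1r mulr1.
Qed.

(** The Leibniz rule for 1 . 1 = 1 gives D 1 = D 1 + D 1. *)
Lemma derivation_const i D c : derivation gr (ufunctions gr) i D ->
  D (of_const c) =1 fun=> 0.
Proof.
move=> [D_st D_lin _ D_leib]; have u1 := ufunctions_of_const gr 1.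
have M := proj1 (D_st _ u1).
have deg1 : has_degree gr 0 (of_const 1 : func E) by case=> // _; rewrite /tdeg big_nil oppr0.
have D1 : D (of_const 1) =1 fun=> 0.
  move=> s; have := D_leib _ _ _ u1 u1 deg1 s.
  rewrite gmul_const1r; last by case: u1.
  rewrite gmul_const1r // gmul_const1l // mulr0 scale1r => /eqP.
  by rewrite -subr_eq0 opprD addNKr oppr_eq0 => /eqP.
(* This writes the constant in the shape a F + G in which linearity is stated. *)
move=> s; have -> : of_const c = (fun s => (c - 1) *: of_const 1 s + of_const 1 s) :> func E.
  apply: funext => -[|x s'] /=; last by rewrite scaler0 addr0.
  by rewrite [_ *: _]mulr1 subrK.
by rewrite D_lin // !D1 scaler0 addr0.
Qed.

(** Both sides are derivations of degree [- d j] that vanish on constants, and [dual_vecE] makes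
    them agree on the forms [xi]. *)
Lemma partial_contract n (d : 'I_n -> int) xi D : dual_basis_homog gr d xi ->
    partials gr d xi D ->
  forall j F, ufunctions gr F -> D j F =1 contract (dual_vec gr d xi j) F.
Proof.
move=> xiB xiD j; have [Dj Djx] := xiD j.
have fr := dual_frame xiB; have ej := frame_mem fr j.
have f2u F : functions gr F -> ufunctions gr F by case.
have deg k := has_degree_of_dual (frame_dual fr k).
apply: (derivation_unique (i := - d j) fr) => //.
- by move=> F _; apply: ufunctions_of_const.
- exact: ufunctions_lin.
- exact: ufunctions_gmul.
- exact: der_linear Dj.
- by move=> k G Gu; apply: (der_leibniz Dj) => //; apply/f2u/functions_of_dual.
- move=> k G Gu s; rewrite (contract_gmul ej _ Gu (deg k)) //.
  exact/f2u/functions_of_dual.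
- by move=> c _ s; rewrite (derivation_const c Dj) /contract; case: s.
- move=> k s; rewrite Djx -(dual_vecE xiB) /contract.
  by case: s => [|x [|y s]].
Qed.

Variable l : seq E -> E.
Hypothesis Hl : Linfty gr l.

Lemma Q_op_unique Q : is_QE gr l Q ->
  forall F, functions gr F -> Q F =1 Q_op gr l F.
Proof.
move=> [Qd Qx]; have fr := std_frame gr.
apply: (derivation_unique (i := 1) fr) => //.
- by move=> F [].
- by move=> F [_ ->]; apply: functions_of_const0.
- exact: functions_lin.
- exact: functions_gmul.
- exact: der_linear Qd.
- exact: Q_op_linear.
- move=> k G Gu; apply: (der_leibniz Qd) => //; first exact: functions_of_dual.
  exact: has_degree_of_dual (frame_dual fr k).
- move=> k G [Gu _] s.
  rewrite (Q_op_gmul Hl _ Gu (has_degree_of_dual (frame_dual fr k))) //.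
  by case: (functions_of_dual gr (std_form k)).
- move=> c [_ /= c0] s; rewrite c0 (linear_on0 (der_linear Qd)); last exact: functions_of_const0.
  by rewrite (linear_on0 (@Q_op_linear _ _ gr l)) //; exact: functions_of_const0.
- move=> k s; rewrite (Qx _ _ (frame_dual fr k)).
  by rewrite (Q_op_of_dual Hl (frame_dual fr k)).
Qed.

Lemma ad_linear s : linear (ad l s).
Proof. by move=> a x y; rewrite /ad -!cats1; apply: Linfty_multilinear Hl _ _ _ _ _. Qed.

Lemma ad_degree t i x : homog gr t -> x \in gr i ->
  ad l (unzip2 t) x \in gr (i + (tdeg t + 1)).
Proof.
move=> ht xi; have := Linfty_degree Hl (t := rcons t (i, x)).
rewrite /homog all_rcons /= xi tdeg_rcons /unzip2 map_rcons => /(_ ht).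
by rewrite addrA [i + _]addrC.
Qed.

(** [unsh] also runs over an empty inner block, absent from the Jacobi identity; that term vanishes
    because [l [::]] is 0. *)
Lemma jacobi_unsh t : homog gr t ->
  unsh (fun u v => l (l (unzip2 u) :: unzip2 v)) t = 0.
Proof.
move=> ht; case: (posnP (size t)) => [/size0nil->|t0].
  by rewrite /= (Linfty_nil Hl) (multilinear0 [::] [::] (Linfty_multilinear Hl)).
rewrite -sum_Sh_unsh big_ord_recl big1 ?add0r => [|s _]; last first.
  rewrite take0 /= (Linfty_nil Hl) (multilinear0 [::] _ (Linfty_multilinear Hl)).
  by rewrite scaler0.
rewrite -[RHS](Linfty_jacobi Hl ht t0) big_add1 /= big_mkord.
by apply: eq_bigr => i _; apply: eq_bigr => s _; rewrite /unzip2 map_take map_drop.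
Qed.

(** * The modular function as a supertrace in a frame, and its closedness *)

Section ModularFunction.

Variables (I : finType) (d : I -> int) (xi : I -> 'Hom(E, K^o)) (e : I -> E).
Hypothesis fr : frame gr d xi e.

(** A map of nonzero degree has no diagonal entries. *)
Lemma frame_str_degree t : homog gr t -> tdeg t != -1 ->
  frame_str d xi e (ad l (unzip2 t)) = 0.
Proof.
move=> ht tN; apply: big1 => j _.
rewrite (frame_dual fr j _ _ (ad_degree ht (frame_mem fr j))) ?scaler0 //.
by rewrite -subr_eq0 opprK addrAC addNr add0r -[1]opprK subr_eq0.
Qed.

Lemma ufunctions_frame_str : ufunctions gr (fun s => frame_str d xi e (ad l s)).
Proof.
split=> [s1 s2 a x y | s1 s2 p q x y xp yq]; rewrite /frame_str /ad.
  rewrite scaler_sumr -big_split; apply: eq_bigr => j _ /=.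
  rewrite !rcons_cat /= (Linfty_multilinear Hl) linearP scalerDr !scalerA.
  by rewrite mulrC.
rewrite scaler_sumr; apply: eq_bigr => j _ /=.
rewrite !rcons_cat /= (Linfty_gsymmetric Hl _ _ xp yq) lfunZ.
by rewrite !scalerA mulrC.
Qed.

Lemma modular_frame_str :
  modular_function gr l = fun s => frame_str d xi e (ad l s).
Proof.
apply: funext => s.
rewrite -[RHS](hom_ext_multilinear gr s (proj1 ufunctions_frame_str)).
apply: eq_hom_ext => t ht _.
have [td|td] := eqVneq (tdeg t) (-1); last by rewrite andbF frame_str_degree.
have tN : t != [::] by apply: contra_eqN td => /eqP->; rewrite tdeg_nil.
rewrite tN; apply: Str_frame => // [|i x xi_]; first exact: ad_linear.
by rewrite -(addr0 i) -(addNr 1) -td; apply: ad_degree.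
Qed.

Lemma Q_op_frame_str :
  Q_op gr l (fun s => frame_str d xi e (ad l s)) =1 fun=> 0.
Proof.
move=> s; rewrite -[RHS](hom_ext0 gr s); apply: eq_hom_ext => t ht _.
have hl u : homog gr u -> l (unzip2 u) \in gr (tdeg u + 1) by apply: Linfty_degree.
(* The bracket raises the degree by 1, so the supertrace only sees the total degree -2. *)
rewrite /Q_form; have [td|td] := eqVneq (tdeg t) (- 2); last first.
  rewrite (_ : unsh _ t = 0) ?scaler0 // -[RHS](unsh0 _ t).
  apply: eq_unsh => u v uv; have [hu hv] := perm_homog uv ht.
  apply: (@frame_str_degree ((tdeg u + 1, l (unzip2 u)) :: v)).
    by apply/andP; split; first exact: hl.
  apply: contraNneq td => td; rewrite (perm_tdeg_cat uv).
  by move: td; rewrite tdeg_cons -(inj_eq (addIr 1)) [in X in _ -> X]addrAC => /eqP->.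
have par u v : perm_eq (u ++ v) t -> oddz (tdeg u) = oddz (tdeg v).
  move=> /perm_tdeg_cat; rewrite td => /(congr1 oddz); rewrite oddzD.
  by case: (oddz (tdeg u)); case: (oddz (tdeg v)).
pose Z := unsh (fun u v : seq (int * E) =>
  frame_str d xi e (ad l (unzip2 v) \o ad l (unzip2 u))) t.
have Z0 : Z = 0.
  (* Swapping the blocks and then the factors gives the exponent |u||v| + |v| + 1, odd because |u|
     and |v| have the same parity; characteristic 0 concludes. *)
  apply/eqP; suff : Z == - Z by rewrite -addr_eq0 -mulr2n mulrn_eq0.
  apply/eqP; rewrite {1}/Z unsh_swap -scaleN1r -unshZ; apply: eq_unsh => u v uv.
  have [hu hv] := perm_homog uv ht.
  rewrite (frame_str_swap fr (q := tdeg v + 1)); first last.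
  - by move=> i x; apply: ad_degree.
  - exact: ad_linear.
  - exact: ad_linear.
  rewrite scalerA signzM -[in RHS](expr1z (-1)); congr (_ *: _).
  by apply: eq_signz; rewrite !oddzE (par u v uv); case: (oddz (tdeg v)).
(* In the Jacobi identity for [t] followed by [e p], the vector [e p] lies in the outer bracket on
   the left and in the inner one on the right. *)
have step p : unsh (fun u v => ad l (l (unzip2 u) :: unzip2 v) (e p)) t =
    - unsh (fun u v => (ad l (unzip2 v) \o ad l (unzip2 u)) (e p)) t.
  have hp : homog gr (rcons t (- d p, e p)).
    by rewrite /homog all_rcons; apply/andP; split; first exact: frame_mem fr p.
  apply/eqP; rewrite -addr_eq0 addrC -(jacobi_unsh hp) unsh_rcons.
  apply/eqP; congr (_ + _); apply: eq_unsh => u v uv; last first.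
    by rewrite /ad /unzip2 map_rcons.
  have [hu hv] := perm_homog uv ht.
  (* The inner bracket moves from first to last argument; with the crossing of [v] by [e p] the
     exponent is |v|(|u| + 1), which is even. *)
  have := tsymmetric_move (t := [::]) (u := v) (v := [::])
    (x := (- d p + (tdeg u + 1), ad l (unzip2 u) (e p)))
    (gsymmetric_unzip2 (Linfty_gsymmetric Hl)).
  rewrite /= cats0 /unzip2 map_cat /= !cats1 /ad => ->.
    rewrite map_rcons; congr (_ *: _); apply: eq_signz.
    rewrite !oddzE (par u v uv).
    by case: (oddz (tdeg v)); case: (oddz (d p)).
  rewrite /homog all_rcons; apply/andP; split=> //.
  exact: ad_degree (frame_mem fr p).
rewrite /frame_str unsh_sum.
transitivity ((-1) ^ (tdeg t + 1) *: - Z : K^o); last by rewrite Z0 oppr0 scaler0.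
congr (_ *: _); rewrite /Z /frame_str unsh_sum -sumrN; apply: eq_bigr => p _.
by rewrite !unshZ -!linear_unsh step linearN scalerN.
Qed.

End ModularFunction.

Lemma functions_modular :
  functions gr (modular_function gr l) /\ has_degree gr 1 (modular_function gr l).
Proof.
have fr := std_frame gr; rewrite (modular_frame_str fr); split.
  split; first exact: ufunctions_frame_str.
  (* The empty sequence has degree 0, not -1. *)
  by have := @frame_str_degree _ _ _ _ fr [::]; rewrite tdeg_nil; apply.
by move=> t; apply: frame_str_degree fr t.
Qed.

End Derivations.

Theorem proposition2p3 (R : realType) (K : numFieldType)
    (HK : K = R :> numFieldType \/ K = complex R :> numFieldType)
    (E : vectType K) (gr : grading E)
    (l : seq E -> E) (Hl : Linfty gr l)
    (Q : func E -> func E) (HQ : is_QE gr l Q) :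
  [/\ functions gr (modular_function gr l) /\
        has_degree gr 1 (modular_function gr l),
      Q (modular_function gr l) =1 (fun=> 0) &
      forall (n : nat) (d : 'I_n -> int) (xi : n.-tuple 'Hom(E, K^o))
             (D : 'I_n -> func E -> func E),
        dual_basis_homog gr d xi -> partials gr d xi D ->
        modular_function gr l =1 divergence xi D 1 Q].
Proof.
have [mF mD] := functions_modular Hl.
split=> // [s | n d xi D xiB xiD].
  by rewrite (Q_op_unique Hl HQ) // (modular_frame_str Hl (std_frame gr))
     (Q_op_frame_str Hl (std_frame gr)).
have fr := dual_frame xiB.
rewrite (modular_frame_str Hl fr) => s.
rewrite /divergence /frame_str scaler_sumr; apply: eq_bigr => j _.
have Qx := QE_dual HQ (frame_dual fr j).
rewrite (partial_contract xiB xiD); last first.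
  have [Q_st _ _ _] := QE_derivation HQ.
  by case: (Q_st _ (functions_of_dual gr (tnth xi j))).
(* The prefactor (-1)^(1+1) is 1, and contraction puts the dual vector in the slot left free by
   [ad]. *)
by rewrite /contract Qx -signzM signzK scale1r.
Qed.
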